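(* Let $d\ge 1$ and $m\ge 1$ be integers. The following bounds hold for the $S$-Tverberg number $\mathbb{T}_S(m)$: \begin{itemize} \item If $S=\mathbb{Z}^{d-a}\times\mathbb{R}^a$ with $a$ an integer, $0\le a\le d$, then $\mathbb{T}_S(m)\le (m-1)\,d\,\bigl(2^{d-a}(a+1)\bigr)+1$. \item If $L',L''$ are sublattices of a lattice $L\subset\mathbb{R}^d$ and $S=L\setminus(L'\cup L'')$, then $\mathbb{T}_S(m)\le 6(m-1)\,d\,2^d+1$. \item If $S\subseteq\mathbb{R}^d$ is a $\mathbb{Q}$-module (i.e. a $\mathbb{Q}$-linear subspace of $\mathbb{R}^d$), then $\mathbb{T}_S(m)\le 2(m-1)d^2+1$. \end{itemize}
   Context: For an arbitrary (not necessarily discrete) set $S\subseteq\mathbb{R}^d$, the $S$-Tverberg number $\mathbb{T}_S(m)$ is the smallest positive integer $N$ (if it exists) such that for any $N$ distinct points of $S$ there is a partition of them into $m$ sets $A_1,\dots,A_m$ such that $\bigcap_{i=1}^m\operatorname{conv}(A_i)$ contains at least one point of $S$; if no such integer exists, $\mathbb{T}_S(m)=\infty$. A lattice in $\mathbb{R}^d$ is a discrete subgroup of $\mathbb{R}^d$ (not necessarily of full rank), and a sublattice is a subgroup of a lattice. *)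

(* Defs.v *)
From mathcomp Require Import all_boot all_order all_algebra.
From mathcomp Require Import all_classical all_reals all_analysis.

Set Implicit Arguments.
Unset Strict Implicit.
Unset Printing Implicit Defensive.

Import Order.TTheory GRing.Theory Num.Theory.
Import numFieldNormedType.Exports.

Local Open Scope classical_set_scope.
Local Open Scope ring_scope.

Definition conv_hull (R : realType) (d : nat) (A : set 'rV[R]_d) :
    set 'rV[R]_d :=
  smallest (@convex_set R 'rV[R]_d) A.

(* The N distinct points form a set X of cardinality N; the parts of a
   [partition] are nonempty, which is no restriction since the convex hull of
   an empty part would be empty. *)
Definition Tverberg_property (R : realType) (d : nat) (S : set 'rV[R]_d)
    (m N : nat) : Prop :=
  forall X : set 'rV[R]_d, X `<=` S -> (X #= `I_N)%card ->
    exists A : 'I_m -> set 'rV[R]_d,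
      partition [set: 'I_m] A X /\
      (\bigcap_(i in [set: 'I_m]) conv_hull (A i)) `&` S !=set0.

(* The least such N > 0, and +oo when there is none. *)
Definition Tverberg_number (R : realType) (d : nat) (S : set 'rV[R]_d)
    (m : nat) : \bar R :=
  if pselect (exists N, `[< (0 < N)%N /\ Tverberg_property S m N >]) is left ex
  then (ex_minn ex)%:R%:E else +oo%E.

(* Z^(d-a) x R^a: only the first d - a coordinates are constrained. *)
Definition mixed_integer_space (R : realType) (d a : nat) : set 'rV[R]_d :=
  [set x | forall i : 'I_d, (i < d - a)%N -> x 0 i \is a Num.int].
Arguments mixed_integer_space : clear implicits.

(* A discrete subgroup of R^d, not necessarily of full rank. *)
Definition is_lattice (R : realType) (d : nat) (L : set 'rV[R]_d) : Prop :=
  zmod_closed [in L] /\ L `<=` isolated L.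

Definition is_sublattice (R : realType) (d : nat) (L' L : set 'rV[R]_d) :
    Prop :=
  zmod_closed [in L'] /\ L' `<=` L.

Definition is_rat_module (R : realType) (d : nat) (S : set 'rV[R]_d) : Prop :=
  zmod_closed [in S] /\
  forall (q : rat) (x : 'rV[R]_d), S x -> S (ratr q *: x).

(* Main.v *)
Require Import Defs.
From mathcomp Require Import all_boot all_order all_algebra finmap.
From mathcomp Require Import all_classical all_reals all_analysis.
From mathcomp Require Import lra ring zify.

(** Put q = (m - 1) d, and call x a centre of a family of points when x lies
    in the convex hull of every subfamily that misses at most q of them.

    A centre x yields a partition into m parts whose hulls all contain x
    ([depth_partition]).  Take a minimal subfamily A with x in its hull: it is
    affinely independent, so a closed halfspace with x on its boundary
    contains at most d points of A.  By separation, removing A leaves a family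
    of which x is still a centre for q - d; after m - 1 removals the remaining
    points form the last part.  So each bound reduces to finding a centre in S.

    If S has Helly number h, every family of more than h q points of S has a
    centre in S ([helly_centre]): any h of the hulls together miss at most h q
    points, so they share a point of the family.  The first two bounds are
    therefore bounds on Helly numbers.  When S is discrete, a family of convex
    sets violating Helly can be enlarged until it yields equally many points
    of S, no two of which have their midpoint in S ([helly_discrete]).  Since
    a lattice L has at most 2 ^ d classes modulo 2 L ([mod2_classes]), this
    gives Helly number 2 ^ d for a lattice.  For L minus L' and L'', more than
    6 * 2 ^ d points would contain seven congruent ones; each of their
    midpoints lies in L' or in L'', a triangle of one colour exists by
    R(3,3) = 6, and its three midpoints in L', say, put a vertex of the
    triangle in L'.  A factor R ^ a multiplies the Helly number by a + 1, by
    applying Helly first to the base and then to the fibre ([helly_mixed]).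

    For a Q-module a centre is found directly ([rational_centre]), by
    induction on the dimension k of the affine span of more than 2 k q points.
    By a theorem of the alternative, either the hulls of all large subfamilies
    have a point in their common relative interior, and rational affine
    combinations of the points, which lie in S, come arbitrarily close to it;
    or there are a + 1 affine functionals with a positive linear relation, of
    which a are independent, each nonnegative on some large subfamily.  In the
    second case every point outside the common zero set is missed by one of
    these subfamilies, so that passing to this flat lowers k by a and loses at
    most (a + 1) q <= 2 a q points. *)

Set Implicit Arguments.
Unset Strict Implicit.
Unset Printing Implicit Defensive.
Import Order.TTheory GRing.Theory Num.Theory.
Import numFieldNormedType.Exports.

Local Open Scope classical_set_scope.
Local Open Scope ring_scope.

(** * Convex and conical combinations *)

Definition incone (R : realFieldType) (n : nat) (I : finType)
    (h : I -> 'rV[R]_n) (B : {set I}) (z : 'rV[R]_n) : Prop :=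
  exists w : I -> R,
    [/\ forall i, 0 <= w i, forall i, i \notin B -> w i = 0
      & \sum_i w i *: h i = z].

Definition inhull (R : realFieldType) (d : nat) (I : finType)
    (v : I -> 'rV[R]_d) (B : {set I}) (x : 'rV[R]_d) : Prop :=
  exists w : I -> R,
    [/\ forall i, 0 <= w i, forall i, i \notin B -> w i = 0,
        \sum_i w i = 1 & \sum_i w i *: v i = x].

(** The point x placed at height 1, so that convex combinations become conical
    combinations and affine functionals become linear ones; [wt] reads off the
    height. *)
Definition homog (R : realFieldType) (d : nat) (x : 'rV[R]_d) : 'rV[R]_(d + 1) :=
  row_mx x 1%:M.

Definition wt (R : realFieldType) (d : nat) : 'cV[R]_(d + 1) := col_mx 0 1%:M.

Section Hulls.
Variables (R : realFieldType) (d : nat).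
Implicit Types (I J : finType).

Lemma homog_wt (x : 'rV[R]_d) : homog x *m wt R d = 1%:M.
Proof. by rewrite mul_row_col mulmx0 add0r mul1mx. Qed.

Lemma homog_inj : injective (@homog R d).
Proof. by move=> x y /eq_row_mx[]. Qed.

Lemma sum_homog I (v : I -> 'rV[R]_d) (w : I -> R) :
  \sum_i w i *: homog (v i) = row_mx (\sum_i w i *: v i) (\sum_i w i)%:M.
Proof.
apply/rowP => k; rewrite summxE; case: (split_ordP k) => j ->{k}.
  rewrite row_mxEl summxE; apply: eq_bigr => i _.
  by rewrite mxE row_mxEl mxE.
rewrite ord1 row_mxEr mxE mulr1n; apply: eq_bigr => i _.
by rewrite mxE row_mxEr mxE mulr1.
Qed.

Lemma inhullE I (v : I -> 'rV[R]_d) (B : {set I}) x :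
  inhull v B x <-> incone (fun i => homog (v i)) B (homog x).
Proof.
split=> [[w [w0 wB w1 wx]]|[w [w0 wB]]].
  by exists w; split=> //; rewrite sum_homog w1 wx.
rewrite sum_homog => /eq_row_mx[wx w1]; exists w; split=> //.
by move/matrixP/(_ 0 0): w1; rewrite !mxE.
Qed.

Lemma inhull_mono I (v : I -> 'rV[R]_d) (A B : {set I}) x :
  A \subset B -> inhull v A x -> inhull v B x.
Proof.
move=> /fintype.subsetP AB [w [w0 wB w1 wx]]; exists w; split=> // i iB.
by apply: wB; apply: contra iB; apply: AB.
Qed.

Lemma inhull_point I (v : I -> 'rV[R]_d) (B : {set I}) i :
  i \in B -> inhull v B (v i).
Proof.
move=> iB; exists (fun j => (j == i)%:R); split=> [j|j jB||].
- exact: ler0n.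
- by case: eqP jB => // ->; rewrite iB.
- by rewrite (bigD1 i) //= eqxx big1 ?addr0 // => j /negbTE ->.
- rewrite (bigD1 i) //= eqxx scale1r big1 ?addr0 // => j /negbTE ->.
  by rewrite scale0r.
Qed.

Lemma inhull_neq0 I (v : I -> 'rV[R]_d) (B : {set I}) x :
  inhull v B x -> B != finset.set0.
Proof.
case=> w [_ wB w1 _]; apply/eqP => B0; move: w1; rewrite big1 => [|i _].
  by move/esym/eqP; rewrite oner_eq0.
by apply: wB; rewrite B0 finset.in_set0.
Qed.

Lemma inhull_trans I J (v : I -> 'rV[R]_d) (u : J -> 'rV[R]_d)
    (A : {set I}) (B : {set J}) x :
  (forall i, i \in A -> inhull u B (v i)) -> inhull v A x -> inhull u B x.
Proof.
move=> AB [w [w0 wA w1 wx]].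
have /choice[c cP] (i : I) : exists c : J -> R, i \in A ->
    [/\ forall j, 0 <= c j, forall j, j \notin B -> c j = 0,
      \sum_j c j = 1 & \sum_j c j *: u j = v i].
  case: (boolP (i \in A)) => [/AB[c cP]|_]; first by exists c.
  by exists (fun=> 0).
exists (fun j => \sum_(i in A) w i * c i j); split=> [j|j jB||].
- by apply: sumr_ge0 => i /cP[c0 _ _ _]; rewrite mulr_ge0.
- by apply: big1 => i /cP[_ cB _ _]; rewrite cB ?mulr0.
- rewrite exchange_big /= -w1 [RHS](bigID [in A]) /= [X in _ + X]big1 ?addr0; last first.
    by move=> i; apply: wA.
  by apply: eq_bigr => i /cP[_ _ c1 _]; rewrite -mulr_sumr c1 mulr1.
- rewrite (eq_bigr (fun j => \sum_(i in A) (w i * c i j) *: u j)); last first.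
    by move=> j _; rewrite scaler_suml.
  rewrite exchange_big /= -wx [RHS](bigID [in A]) /= [X in _ + X]big1 ?addr0; last first.
    by move=> i /wA ->; rewrite scale0r.
  apply: eq_bigr => i /cP[_ _ _ cv].
  by rewrite -cv scaler_sumr; apply: eq_bigr => j _; rewrite scalerA.
Qed.

End Hulls.

Section Convex.
Variables (R : realType) (d : nat).

Lemma convexP (K : set 'rV[R]_d) :
  @convex_set R 'rV[R]_d K <->
  forall (x y : 'rV[R]_d) (t : R), K x -> K y -> 0 <= t -> t <= 1 ->
    K (t *: x + (1 - t) *: y).
Proof.
split=> [cK x y t Kx Ky t0 t1|cK].
  by have := cK x y (Itv01 t0 t1); rewrite !inE => /(_ Kx Ky).
apply/convex_setW => x y /set_mem Kx /set_mem Ky t t0 t1; apply/mem_set.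
by apply: cK => //; exact: ltW.
Qed.

(** Induction on the number of points: one of positive weight splits off, and
    the others, renormalized, form a convex combination of fewer points. *)
Lemma convex_inhull (K : set 'rV[R]_d) (I : finType) (v : I -> 'rV[R]_d) (B : {set I}) x :
  @convex_set R 'rV[R]_d K -> (forall i, i \in B -> K (v i)) ->
  inhull v B x -> K x.
Proof.
move=> /convexP cK; move: {2}#|B| (leqnn #|B|) => n.
elim: n B x => [|n IH] B x.
  rewrite leqn0 cards_eq0 => /eqP-> _ /inhull_neq0; by rewrite eqxx.
move=> Bn KB [w [w0 wB w1 wx]].
have [i iB wi] : exists2 i, i \in B & w i != 0.
  apply: contrapT => nB; move: w1; rewrite big1; last first.
    move=> i _; apply: contrapT => /eqP wi; apply: nB; exists i => //.
    by apply: contraT => /wB wi0; rewrite wi0 eqxx in wi.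
  by move/esym/eqP; rewrite oner_eq0.
have le1 : w i <= 1.
  by rewrite -w1 (bigD1 i) //= lerDl sumr_ge0.
have [wi1|wi1] := eqVneq (w i) 1.
  have wj j : j != i -> w j = 0.
    move=> ji; apply/eqP; have : \sum_(j | j != i) w j == 0.
      by move: w1; rewrite (bigD1 i) //= wi1 => /(canRL (addKr _)) ->; rewrite addNr.
    rewrite psumr_eq0 => [|k _]; last exact: w0.
    by move=> /allP/(_ j); rewrite mem_index_enum ji /=; apply.
  rewrite -wx (bigD1 i) //= wi1 scale1r big1 ?addr0; first exact: KB.
  by move=> j /wj ->; rewrite scale0r.
have s0 : 0 < 1 - w i by rewrite subr_gt0 lt_neqAle wi1.
have sE : \sum_(j | j != i) w j = 1 - w i.
  by have := w1; rewrite (bigD1 i) //= => <-; rewrite addrAC subrr add0r.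
pose y := \sum_(j | j != i) (w j / (1 - w i)) *: v j.
have Ky : K y.
  apply: (IH (B :\ i)).
  - by have := cardsD1 i B; rewrite iB; lia.
  - by move=> j; rewrite in_setD1 => /andP[_]; apply: KB.
  exists (fun j => if j != i then w j / (1 - w i) else 0); split.
  - by move=> j; case: ifP => // _; rewrite divr_ge0 // ltW.
  - move=> j; rewrite in_setD1; case: (boolP (j != i)) => //= _ /wB ->.
    by rewrite mul0r.
  - by rewrite -big_mkcond /= -mulr_suml sE divff // gt_eqF.
  - rewrite /y [RHS]big_mkcond /=; apply: eq_bigr => j _; case: ifP => // _.
    by rewrite scale0r.
have -> : x = w i *: v i + (1 - w i) *: y.
  rewrite -wx (bigD1 i) //=; congr (_ + _).
  rewrite /y scaler_sumr; apply: eq_bigr => j _.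
  by rewrite scalerA mulrCA divff ?mulr1 // gt_eqF.
by apply: cK => //; exact: KB.
Qed.

Lemma convex_inhull_set (I : finType) (v : I -> 'rV[R]_d) (B : {set I}) :
  @convex_set R 'rV[R]_d [set x | inhull v B x].
Proof.
apply/convexP => x y t [w [w0 wB w1 wx]] [c [c0 cB c1 cy]] t0 t1.
exists (fun i => t * w i + (1 - t) * c i); split=> [i|i iB||].
- by rewrite addr_ge0 // mulr_ge0 // subr_ge0.
- by rewrite wB // cB // !mulr0 addr0.
- by rewrite big_split /= -!mulr_sumr w1 c1 !mulr1 addrC subrK.
- rewrite -wx -cy !scaler_sumr -big_split /=; apply: eq_bigr => i _.
  by rewrite !scalerA -scalerDl.
Qed.

Lemma inhull_conv_hull (I : finType) (v : I -> 'rV[R]_d) (B : {set I}) x :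
  inhull v B x -> @conv_hull R d [set v i | i in [set` B]] x.
Proof.
move=> vBx K [cK BK]; apply: (convex_inhull cK _ vBx) => i iB.
by apply: BK; exists i => //; apply/mem_set.
Qed.

End Convex.

(** * Theorems of the alternative and minimal representations *)

Section Alternatives.
Variables (R : realFieldType) (V : lmodType R) (W : V -> Prop).
Hypothesis W0 : W 0.
Hypothesis WP : forall a x y, W x -> W y -> W (a *: x + y).
Variable I : finType.

Let linearF (f : V -> R) := forall a x y, f (a *: x + y) = a * f x + f y.

(** Bartl's induction: if dropping f i0 breaks the implication, some x'
    witnesses it with f i0 x' > 0, and subtracting multiples of f i0 from all
    functionals so that they vanish at x' reduces to a smaller family.  The
    domain W is any subspace, which lets the unknowns be tied together by
    linear equations. *)
Lemma farkas (A : {set I}) (f : I -> V -> R) (g : V -> R) :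
  (forall i, linearF (f i)) -> linearF g ->
  (forall x, W x -> (forall i, i \in A -> f i x <= 0) -> g x <= 0) ->
  exists u : I -> R,
    [/\ forall i, 0 <= u i, forall i, i \notin A -> u i = 0
      & forall x, W x -> g x = \sum_i u i * f i x].
Proof.
have [n] := ubnP #|A|; elim: n A f g => // n IH A f g An fL gL fg.
have [A0|[i0 iA]] := set_0Vmem A.
  exists (fun=> 0); split=> // x Wx; rewrite big1; last first.
    by move=> i _; rewrite mul0r.
  have gle y : W y -> g y <= 0 by move=> Wy; apply: fg => // i; rewrite A0 finset.in_set0.
  apply/eqP; rewrite eq_le gle //=.
  have := gle (- x); rewrite -[- x]addr0 -scaleN1r.
  have g0 : g 0 = 0 by have := gL 1 0 0; rewrite scaler0 addr0; lra.
  rewrite gL g0 => /(_ (WP (-1) Wx W0)); lra.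
have An' : (#|A :\ i0| < n)%N by have := cardsD1 i0 A; rewrite iA; lia.
have [[x' [Wx' fx' gx']]|none] := pselect (exists x', [/\ W x',
    forall i, i \in A :\ i0 -> f i x' <= 0 & 0 < g x']); last first.
  have [u [u0 uA ug]] : exists u : I -> R,
    [/\ forall i, 0 <= u i, forall i, i \notin A :\ i0 -> u i = 0
      & forall x, W x -> g x = \sum_i u i * f i x].
    apply: IH => // x Wx fx; rewrite leNgt; apply/negP => gx.
    by apply: none; exists x.
  exists u; split=> // i iA'; apply: uA.
  by rewrite in_setD1 negb_and iA' orbT.
have c0 : 0 < f i0 x'.
  rewrite ltNge; apply/negP => fle; suff : g x' <= 0 by lra.
  apply: fg => // i iA'; have [->//|ii0] := eqVneq i i0.
  by apply: fx'; rewrite in_setD1 ii0.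
pose r x := f i0 x / f i0 x'.
pose p (k : V -> R) x := k x - k x' * r x.
have pL k : linearF k -> linearF (p k).
  by move=> kL a x y; rewrite /p /r kL (fL i0) mulrDl; lra.
have pE k x : linearF k -> p k x = k (- r x *: x' + x).
  by move=> kL; rewrite /p kL; lra.
have [u [u0 uA ug]] : exists u : I -> R,
    [/\ forall i, 0 <= u i, forall i, i \notin A :\ i0 -> u i = 0
      & forall x, W x -> p g x = \sum_i u i * p (f i) x].
  apply: IH => //; [by move=> i; apply: pL|exact: pL|].
  move=> x Wx fx; rewrite pE //; apply: fg => [|i iA']; first exact: WP.
  rewrite -pE //; have [->|ii0] := eqVneq i i0; last first.
    by apply: fx; rewrite in_setD1 ii0.
  by rewrite /p /r mulrC divfK ?subrr // gt_eqF.
pose c := (g x' - \sum_i u i * f i x') / f i0 x'.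
have ui0 : u i0 = 0 by apply: uA; rewrite setD11.
exists (fun i => if i == i0 then c else u i); split.
- move=> i; case: eqP => // _; rewrite divr_ge0 ?(ltW c0) // subr_ge0.
  apply: le_trans (ltW gx'); apply: sumr_le0 => j _.
  have [jA|/uA->] := boolP (j \in A :\ i0); last by rewrite mul0r.
  by rewrite mulr_ge0_le0 // fx'.
- move=> i iA'; case: eqP => [ii0|_]; first by rewrite ii0 iA in iA'.
  by apply: uA; rewrite in_setD1 negb_and iA' orbT.
- move=> x Wx; rewrite (bigD1 i0) //= eqxx.
  have -> : \sum_(i | i != i0) (if i == i0 then c else u i) * f i x
            = \sum_i u i * f i x.
    rewrite [RHS](bigD1 i0) //= ui0 mul0r add0r.
    by apply: eq_bigr => i /negbTE ->.
  have := ug x Wx; rewrite /p.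
  under eq_bigr do rewrite mulrBr mulrA.
  rewrite sumrB -mulr_suml => /(canRL (subrK _)) ->.
  by rewrite /c /r; field; rewrite gt_eqF.
Qed.

(** Apply [farkas] to each functional - f j, and add up the relations. *)
Lemma stiemke (f : I -> V -> R) :
  (forall i, linearF (f i)) ->
  (forall x, W x -> (forall i, 0 <= f i x) -> forall i, f i x = 0) ->
  exists u : I -> R, (forall i, 0 < u i) /\
    forall x, W x -> \sum_i u i * f i x = 0.
Proof.
move=> fL f0.
have fN i x : f i (- x) = - f i x.
  have fi0 : f i 0 = 0 by have := fL i 1 0 0; rewrite scaler0 addr0; lra.
  by rewrite -[- x]addr0 -scaleN1r fL fi0 mulN1r addr0.
have /choice[u uP] (j : I) : exists u : I -> R, (forall i, 0 <= u i) /\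
    forall x, W x -> - f j x = \sum_i u i * f i x.
  have [|a x y|x Wx fx|u [u0 _ uf]] := @farkas [set: I]%SET f (fun x => - f j x).
  - exact: fL.
  - by rewrite fL; lra.
  - have -> : - f j x = 0; last by [].
    rewrite -fN; apply: f0 => [|i].
      by rewrite -[- x]addr0 -scaleN1r; apply: WP.
    by rewrite fN oppr_ge0 fx // finset.in_setT.
  - by exists u.
exists (fun i => 1 + \sum_j u j i); split=> [i|x Wx].
  by rewrite ltr_pwDl // sumr_ge0 // => j _; case: (uP j).
under eq_bigr do rewrite mulrDl mul1r mulr_suml.
rewrite big_split /= exchange_big /= -big_split /= big1 // => j _.
by case: (uP j) => _ /(_ x Wx) <-; rewrite subrr.
Qed.

End Alternatives.

Section Caratheodory.
Variables (R : realFieldType) (n : nat) (I : finType).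
Implicit Types (h : I -> 'rV[R]_n) (A B : {set I}).

Definition indep h A : Prop :=
  forall c : I -> R, (forall i, i \notin A -> c i = 0) ->
    \sum_i c i *: h i = 0 -> forall i, c i = 0.

(** A linear relation among the vectors used can be subtracted from the
    coefficients until one of them vanishes, so a representation with smallest
    support uses independent vectors. *)
Lemma caratheodory h B z : incone h B z ->
  exists A (w : I -> R), [/\ A \subset B, indep h A, forall i, i \in A -> 0 < w i,
    forall i, i \notin A -> w i = 0 & \sum_i w i *: h i = z].
Proof.
have [m] := ubnP #|B|; elim: m B => // m IH B Bm [w [w0 wB wz]].
have drop i (w' : I -> R) : i \in B -> (forall j, 0 <= w' j) ->
    (forall j, j \notin B -> w' j = 0) -> w' i = 0 -> \sum_j w' j *: h j = z ->
    exists A (w : I -> R), [/\ A \subset B, indep h A, forall i, i \in A -> 0 < w i,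
    forall i, i \notin A -> w i = 0 & \sum_i w i *: h i = z].
  move=> iB w'0 w'B w'i w'z.
  have [||A [c [AB Ai c0 cA cz]]] := IH (B :\ i); last 1 first.
  - by exists A, c; split=> //; apply: fintype.subset_trans AB (subD1set _ _).
  - by have := cardsD1 i B; rewrite iB; lia.
  exists w'; split=> // j; rewrite in_setD1 negb_and negbK => /orP[/eqP->//|].
  exact: w'B.
have [[i [iB wi]]|Bpos] := pselect (exists i, i \in B /\ w i = 0).
  exact: (drop i w).
have [Bi|/existsNP[c /not_implyP[cB /not_implyP[ch /existsNP[i0 ci0]]]]] :=
  pselect (indep h B).
  exists B, w; split=> // i iB; rewrite lt_neqAle w0 andbT.
  by apply/eqP => wi; apply: Bpos; exists i.
have [{cB ch ci0}c cB ch] : exists2 c : I -> R, forall i, i \notin B -> c i = 0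
    & \sum_i c i *: h i = 0 /\ exists i, 0 < c i.
  have [cp|cn] := ltP 0 (c i0); first by exists c => //; split=> //; exists i0.
  exists (fun i => - c i) => [i /cB->|]; first by rewrite oppr0.
  split; last by exists i0; rewrite oppr_gt0 lt_neqAle cn andbT; apply/eqP.
  by under eq_bigr do rewrite scaleNr; rewrite sumrN ch oppr0.
case: ch => ch [{}i0 ci0].
have [i1 ci1 wmin] := @arg_minP _ _ _ i0 (fun i => 0 < c i) (fun i => w i / c i) ci0.
have i1B : i1 \in B by apply: contraLR ci1 => /cB ->; rewrite ltxx.
pose t := w i1 / c i1.
have t0 : 0 <= t by rewrite divr_ge0 // ltW.
apply: (drop i1 (fun j => w j - t * c j)) => // [j|j jB||].
- rewrite subr_ge0; have [cj|cj] := ltP 0 (c j); first by rewrite -ler_pdivlMr // wmin.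
  by apply: le_trans (w0 j); rewrite mulr_ge0_le0.
- by rewrite wB // cB // mulr0 subrr.
- by rewrite /t divfK ?subrr // gt_eqF.
- under eq_bigr do rewrite scalerBl -scalerA.
  by rewrite sumrB -scaler_sumr ch scaler0 subr0.
Qed.

Lemma sum_enum_val A (F : I -> 'rV[R]_n) :
  (forall i, i \notin A -> F i = 0) -> \sum_i F i = \sum_(k < #|A|) F (enum_val k).
Proof.
move=> FA; rewrite (bigID [in A]) /= [X in _ + X]big1 ?addr0; last exact: FA.
by rewrite big_enum_val.
Qed.

Lemma indep_row_free h A : indep h A ->
  row_free (\matrix_(k < #|A|) h (enum_val k)).
Proof.
move=> Ai; apply: inj_row_free => u uh; apply/rowP => k; rewrite mxE.
pose c i := if i \in A =P true is ReflectT iA then u 0 (enum_rank_in iA i) else 0.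
have cE l : c (enum_val l) = u 0 l.
  rewrite /c; case: eqP => [iA|]; last by rewrite enum_valP.
  by rewrite enum_valK_in.
rewrite -cE; apply: Ai => [i iA|]; first by rewrite /c; case: eqP => // jA; rewrite jA in iA.
rewrite (@sum_enum_val A) => [|i iA]; last first.
  by rewrite /c; case: eqP => [jA|_]; [rewrite jA in iA|rewrite scale0r].
rewrite -[RHS]uh mulmx_sum_row; apply: eq_bigr => l _.
by rewrite cE rowK.
Qed.

Lemma indep_card h A : indep h A -> (#|A| <= n)%N.
Proof. by move=> /indep_row_free/eqP <-; apply: rank_leq_col. Qed.

Lemma indep_separates h A (f : 'cV[R]_n) : indep h A -> (n <= #|A|)%N ->
  (forall i, i \in A -> h i *m f = 0) -> f = 0.
Proof.
move=> Ai An hf; have Af := indep_row_free Ai.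
set M := (\matrix_(k < #|A|) h (enum_val k)) in Af.
have /row_fullP[M' M'M] : row_full M.
  by rewrite /row_full eqn_leq rank_leq_col (eqP Af).
rewrite -[f]mul1mx -M'M -mulmxA (_ : M *m f = 0) ?mulmx0 //.
apply/row_matrixP => k; rewrite row_mul rowK row0; apply: hf.
exact: enum_valP.
Qed.

End Caratheodory.

(** * Deep points and partitions *)

Section Depth.
Variables (R : realFieldType) (d : nat) (I : finType).
Implicit Types (v : I -> 'rV[R]_d) (A B Y : {set I}).

Lemma eq_row_dot n (a b : 'rV[R]_n) :
  (forall f : 'cV_n, (a *m f) 0 0 = (b *m f) 0 0) -> a = b.
Proof.
move=> ab; apply/rowP => j; have := ab (delta_mx j 0).
by rewrite -!colE !mxE.
Qed.

Lemma dot_linear n (a : 'rV[R]_n) (c : R) (f g : 'cV_n) :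
  (a *m (c *: f + g)) 0 0 = c * (a *m f) 0 0 + (a *m g) 0 0.
Proof. by rewrite mulmxDr -scalemxAr !mxE. Qed.

Lemma dot_sum n (w : I -> R) (h : I -> 'rV[R]_n) (f : 'cV_n) :
  ((\sum_i w i *: h i) *m f) 0 0 = \sum_i w i * (h i *m f) 0 0.
Proof.
rewrite mulmx_suml summxE; apply: eq_bigr => i _.
by rewrite -scalemxAl mxE.
Qed.

Lemma incone_or_separated n (h : I -> 'rV[R]_n) B z : incone h B z \/
  exists f : 'cV_n, (forall i, i \in B -> (h i *m f) 0 0 <= 0) /\ 0 < (z *m f) 0 0.
Proof.
case: (pselect (forall f : 'cV_n,
  (forall i, i \in B -> (h i *m f) 0 0 <= 0) -> (z *m f) 0 0 <= 0)); last first.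
  by move=> /existsNP[f /not_implyP[hf /negP zf]]; right; exists f; rewrite ltNge.
move=> hz; left.
have [||i||f _|u [u0 uB uz]] := @farkas R 'cV_n (fun=> True) _ _ I B
   (fun i f => (h i *m f) 0 0) (fun f => (z *m f) 0 0) => //.
- by move=> a x y; exact: dot_linear.
- by move=> a x y; exact: dot_linear.
- exact: hz.
exists u; split=> //; apply: eq_row_dot => f; by rewrite uz // dot_sum.
Qed.

(** The affine functional f vanishes at p, so it describes a halfspace with p on
    its boundary.  It is nonzero even when B is empty, which is why d must be
    positive. *)
Lemma point_halfspace v B p : (0 < d)%N -> ~ inhull v B p ->
  exists f : 'cV_(d + 1), [/\ f != 0, homog p *m f = 0
    & forall i, i \in B -> (homog (v i) *m f) 0 0 < 0].
Proof.
move=> d0 /inhullE vBp; have [B0|[b bB]] := set_0Vmem B.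
  have C0 : cokermx (homog p) != 0.
    rewrite -mxrank_eq0 mxrank_coker; have := rank_leq_row (homog p); lia.
  have [j Cj] : exists j, col j (cokermx (homog p)) != 0.
    apply/existsP; apply: contraNT C0 => /existsPn C0; apply/eqP/matrixP => i j.
    by have /negPn/eqP/matrixP/(_ i 0) := C0 j; rewrite !mxE.
  exists (col j (cokermx (homog p))); split=> //; last first.
    by move=> i; rewrite B0 finset.in_set0.
  by rewrite colE mulmxA mulmx_coker mul0mx.
have [//|[f [fB fp]]] := incone_or_separated (fun i => homog (v i)) B (homog p).
have fE x : (homog x *m (f - (homog p *m f) 0 0 *: wt R d)) 0 0
            = (homog x *m f) 0 0 - (homog p *m f) 0 0.
  by rewrite mulmxBr -scalemxAr homog_wt !mxE /= mulr1.
have neg i : i \in B -> (homog (v i) *m (f - (homog p *m f) 0 0 *: wt R d)) 0 0 < 0.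
  by move=> /fB fi; rewrite fE subr_lt0; apply: le_lt_trans fi fp.
exists (f - (homog p *m f) 0 0 *: wt R d); split => //.
- by apply: contraPneq (neg _ bB) => ->; rewrite mulmx0 mxE ltxx.
- by apply/rowP => j; rewrite [j]ord1 fE [RHS]mxE subrr.
Qed.

(** The partition is given as a colouring c.  In the induction step the new
    colour class is a minimal subfamily A whose hull contains p.  If p were
    outside the hull of some B in the rest, a functional vanishing at p and
    negative on B would be nonnegative on at most d points of A: when A has d + 1
    points, they are a basis and p is a positive combination of them, so it is
    negative on at least one of them.  Then B together with the other points
    of A would contradict the depth of p in Y. *)
Lemma depth_partition v p m Y : (0 < d)%N ->
  (forall B, B \subset Y -> (#|Y :\: B| <= m * d)%N -> inhull v B p) ->
  exists c : I -> 'I_m.+1, forall k, inhull v [set i in Y | c i == k] p.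
Proof.
move=> d0; elim: m Y => [|m IH] Y deep.
  exists (fun=> ord0) => k; apply: inhull_mono (deep Y _ _) => //.
    by apply/fintype.subsetP => i iY; rewrite inE iY [k]ord1 eqxx.
  by rewrite finset.setDv cards0.
have /inhullE/caratheodory : inhull v Y p.
  by apply: deep => //; rewrite finset.setDv cards0.
case=> A [w [AY Ai wA wNA wp]].
have [B BYA cardB|c cP] := IH (Y :\: A).
  apply: contrapT => /(point_halfspace d0)[f [f0 fp fB]].
  pose A' := [set i in A | (homog (v i) *m f) 0 0 < 0].
  have cardA : (#|A :\: A'| <= d)%N.
    have [A'0|[a aA']] := set_0Vmem A'; last first.
      have := indep_card Ai; have : (#|A :\: A'| < #|A|)%N; last lia.
      apply: proper_card; apply/properP; split; first exact: subsetDl.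
      exists a; last by rewrite finset.in_setD aA'.
      by move: aA'; rewrite inE => /andP[].
    rewrite A'0 finset.setD0 leqNgt; apply/negP => dA.
    move/eqP: f0; apply; apply: indep_separates Ai _ _; first by rewrite addn1.
    have fA i : i \in A -> 0 <= (homog (v i) *m f) 0 0.
      move=> iA; rewrite leNgt; apply/negP => fi.
      by have := finset.in_set0 i; rewrite -A'0 inE iA fi.
    have s0 : \sum_i w i * (homog (v i) *m f) 0 0 = 0.
      by rewrite -dot_sum wp fp mxE.
    move=> i iA; apply/rowP => j; rewrite ord1 [RHS]mxE.
    move/eqP: s0; rewrite psumr_eq0 => [/allP/(_ i)|k _].
      by rewrite mem_index_enum mulf_eq0 gt_eqF ?wA //= => /(_ isT)/eqP.
    have [kA|/wNA->] := boolP (k \in A); last by rewrite mul0r.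
    by rewrite mulr_ge0 ?fA ?ltW ?wA.
  have /inhullE[u [u0 uB up]] : inhull v (B :|: A') p.
    apply: deep.
      rewrite finset.subUset (fintype.subset_trans BYA (subsetDl _ _)) /=.
      apply: fintype.subset_trans AY; apply/fintype.subsetP => i.
      by rewrite inE => /andP[].
    apply: (@leq_trans (#|(Y :\: A) :\: B| + #|A :\: A'|)%N); last by rewrite mulSn; lia.
    apply: leq_trans (leq_card_setU _ _); apply: subset_leq_card.
    apply/fintype.subsetP => i; rewrite !inE; case: (i \in A) => //=; case: (i \in B) => //=.
      by rewrite ?andbT ?orbF => /andP[].
    by rewrite orbF.
  have neg i : i \in B :|: A' -> (homog (v i) *m f) 0 0 < 0.
    by rewrite finset.in_setU => /orP[/fB//|]; rewrite inE => /andP[].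
  have [i [iBA ui]] : exists i, i \in B :|: A' /\ 0 < u i.
    apply: contrapT => nu; have u00 i : u i = 0.
      have [iBA|/uB//] := boolP (i \in B :|: A').
      apply/eqP; rewrite eq_le u0 andbT leNgt; apply/negP => ui.
      by apply: nu; exists i.
    move: up; rewrite big1; last by move=> i _; rewrite u00 scale0r.
    move/(congr1 (mulmx^~ (wt R d))); rewrite mul0mx homog_wt.
    by move/matrixP/(_ 0 0); rewrite !mxE; apply/eqP; rewrite eq_sym oner_eq0.
  have : \sum_i u i * (homog (v i) *m f) 0 0 = 0.
    by rewrite -dot_sum up fp mxE.
  apply/eqP; rewrite lt_eqF // (bigD1 i) //= -[ltRHS]addr0.
  rewrite ltr_leD ?pmulr_rlt0 ?neg //; apply: sumr_le0 => j _.
  have [jBA|/uB->] := boolP (j \in B :|: A'); last by rewrite mul0r.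
  by rewrite mulr_ge0_le0 ?u0 // ltW // neg.
exists (fun i => if i \in A then ord0 else lift ord0 (c i)) => k.
case: (unliftP ord0 k) => [k' ->|->].
  apply: inhull_mono (cP k'); apply/fintype.subsetP => i.
  rewrite !inE => /andP[/andP[iA iY] /eqP ci].
  by rewrite iY (negbTE iA) ci eqxx.
apply: (@inhull_mono _ _ _ v A).
  by apply/fintype.subsetP => i iA; rewrite !inE (fintype.subsetP AY) // iA eqxx.
apply/inhullE; exists w; split=> // i.
by have [/wA/ltW|/wNA->] := boolP (i \in A).
Qed.

End Depth.

(** * Helly numbers *)

Definition helly (R : realType) (d : nat) (S : set 'rV[R]_d) (h : nat) : Prop :=
  forall (T : finType) (K : T -> set 'rV[R]_d),
    (forall t, @convex_set R 'rV[R]_d (K t)) ->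
    (forall J : {set T}, (#|J| <= h)%N ->
       exists2 x, S x & forall t, t \in J -> K t x) ->
    exists2 x, S x & forall t, K t x.

Lemma card_bigcup_le (T J : finType) (P : pred J) (F : J -> {set T}) (q : nat) :
  (forall j, P j -> (#|F j| <= q)%N) ->
  (#|(\bigcup_(j | P j) F j)%SET| <= #|[pred j | P j]| * q)%N.
Proof.
move=> Fq; rewrite -sum_nat_const; elim/big_ind2: _ => [|A a B b Aa Bb|j /Fq //].
  by rewrite cards0.
by apply: leq_trans (leq_card_setU _ _) _; apply: leq_add.
Qed.

Section Helly.
Variables (R : realType) (d : nat).
Implicit Types (S : set 'rV[R]_d).

(** A subfamily minimal among those without a common point in S provides, for
    each of its members t, a point p t of S in all the other members. *)
Lemma helly_critical S h :
  (forall (T : finType) (K : T -> set 'rV[R]_d) (p : T -> 'rV[R]_d),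
     (forall t, @convex_set R 'rV[R]_d (K t)) -> (forall t, S (p t)) ->
     (forall s t, s != t -> K t (p s)) ->
     ~ (exists2 x, S x & forall t, K t x) -> (#|T| <= h)%N) ->
  helly S h.
Proof.
move=> crit T K cK Kh; apply: contrapT => nK.
pose bad (J : {set T}) := `[< ~ exists2 x, S x & forall t : T, t \in J -> K t x >].
have [J /minsetP[/asboolP Jbad Jmin]] : {J | minset bad J}.
  apply: ex_minset; exists [set: T]%SET; apply/asboolP => -[x Sx Kx].
  by apply: nK; exists x => // t; apply: Kx; rewrite finset.in_setT.
have /choice[p pP] (t : {t | t \in J}) :
    exists x, S x /\ forall s, s \in J :\ val t -> K s x.
  apply: contrapT => nt; suff : J :\ val t = J.
    by move/finset.setP/(_ (val t)); rewrite setD11 (valP t).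
  apply: Jmin; last exact: subD1set.
  by apply/asboolP => -[x Sx Kx]; apply: nt; exists x.
suff hJ : (#|{: {t | t \in J}}| <= h)%N.
  by apply: Jbad; apply: Kh; rewrite card_sig in hJ.
apply: (crit _ (fun t => K (val t)) p) => [t|t|s t st|[x Sx Kx]].
- exact: cK.
- by case: (pP t).
- case: (pP s) => _; apply; rewrite in_setD1 (valP t) andbT.
  by rewrite eq_sym (inj_eq val_inj).
- by apply: Jbad; exists x => // t tJ; apply: (Kx (exist _ t tJ)).
Qed.

(** Any h of the hulls in question together miss at most h * q points of the
    family, hence some point of it belongs to all of them. *)
Lemma helly_centre S h (I : finType) (v : I -> 'rV[R]_d) (Y : {set I}) q :
  helly S h -> (forall i, i \in Y -> S (v i)) -> (h * q < #|Y|)%N ->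
  exists2 x, S x & forall B : {set I}, B \subset Y -> (#|Y :\: B| <= q)%N ->
    inhull v B x.
Proof.
move=> Sh SY hq.
pose K (B : {set I}) : set 'rV[R]_d :=
  [set x | B \subset Y -> (#|Y :\: B| <= q)%N -> inhull v B x].
suff [x Sx Kx] : exists2 x, S x & forall B, K B x by exists x.
apply: Sh => [B|J Jh].
  apply/convexP => x y t Kx Ky t0 t1 BY Bq.
  exact: ((convexP _).1 (@convex_inhull_set R d I v B) x y t (Kx BY Bq) (Ky BY Bq) t0 t1).
pose U := (\bigcup_(B in J | (#|Y :\: B| <= q)%N) (Y :\: B))%SET.
have Uq : (#|U| <= h * q)%N.
  apply: leq_trans (card_bigcup_le _) _; first by move=> B /andP[_]; apply.
  rewrite leq_mul2r; apply/orP; right; apply: leq_trans Jh.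
  by apply: subset_leq_card; apply/fintype.subsetP => B; rewrite inE => /andP[].
have [i iY iU] : exists2 i, i \in Y & i \notin U.
  apply: contrapT => nU; have : Y \subset U.
    apply/fintype.subsetP => i iY; apply: contrapT => /negP iU.
    by apply: nU; exists i.
  by move/subset_leq_card; lia.
exists (v i) => [|B BJ BY Bq]; first exact: SY.
apply: inhull_point; apply: contraNT iU => iB.
by apply/bigcupP; exists B; rewrite ?BJ //= finset.in_setD iB iY.
Qed.

Lemma maxr_pos_neg (a : R) : Num.max a 0 - Num.max (- a) 0 = a.
Proof.
have [a0|a0] := leP 0 a; first by rewrite max_r ?subr0 // oppr_le0.
by rewrite max_l ?oppr_ge0 ?ltW //; lra.
Qed.

(** Split a linear relation among the lifted points according to the signs of
    its coefficients. *)
Lemma radon (T : finType) (p : T -> 'rV[R]_d) :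
  ~ indep (fun t => homog (p t)) [set: T]%SET ->
  exists x (P N : {set T}), [/\ {in P, forall t, t \notin N}, inhull p P x & inhull p N x].
Proof.
move=> /existsNP[c /not_implyP[_ /not_implyP[ch /existsNP[t0 ct0]]]].
have [csum cp] : \sum_t c t = 0 /\ \sum_t c t *: p t = 0.
  move: ch; rewrite sum_homog -[RHS](@row_mx0 _ 1 d 1) => /eq_row_mx[-> c0].
  by split=> //; move/matrixP/(_ 0 0): c0; rewrite !mxE mulr1n.
pose s := \sum_t Num.max (c t) 0.
have sN : s = \sum_t Num.max (- c t) 0.
  apply/eqP; rewrite -subr_eq0 -sumrB -[X in _ == X]csum; apply/eqP.
  by apply: eq_bigr => t _; rewrite maxr_pos_neg.
have s0 : 0 < s.
  rewrite lt_neqAle; apply/andP; split; last first.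
    by apply: sumr_ge0 => t _; rewrite le_max lexx orbT.
  apply/eqP => s0; apply: ct0.
  have cle : c t0 <= 0.
    have : Num.max (c t0) 0 <= s.
      rewrite /s (bigD1 t0) //= lerDl; apply: sumr_ge0 => t _.
      by rewrite le_max lexx orbT.
    by rewrite -s0 ge_max => /andP[].
  have cge : - c t0 <= 0.
    have : Num.max (- c t0) 0 <= s.
      rewrite sN (bigD1 t0) //= lerDl; apply: sumr_ge0 => t _.
      by rewrite le_max lexx orbT.
    by rewrite -s0 ge_max => /andP[].
  lra.
exists (\sum_t (Num.max (c t) 0 / s) *: p t).
exists [set t | 0 < c t]%SET, [set t | c t < 0]%SET; split.
- by move=> t; rewrite !inE => ct; rewrite -leNgt ltW.
- exists (fun t => Num.max (c t) 0 / s); split=> //.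
  + by move=> t; rewrite divr_ge0 ?(ltW s0) // le_max lexx orbT.
  + by move=> t; rewrite inE -leNgt => ct; rewrite max_r // mul0r.
  + by rewrite -mulr_suml divff // gt_eqF.
- exists (fun t => Num.max (- c t) 0 / s); split=> //.
  + by move=> t; rewrite divr_ge0 ?(ltW s0) // le_max lexx orbT.
  + by move=> t; rewrite inE -leNgt => ct; rewrite max_r ?oppr_le0 // mul0r.
  + by rewrite -mulr_suml -sN divff // gt_eqF.
  + apply/eqP; rewrite -subr_eq0 -sumrB -[X in _ == X](scaler0 _ (- s^-1)).
    rewrite -[X in _ *: X]cp scaler_sumr; apply/eqP; apply: eq_bigr => t _.
    rewrite scalerA -scalerBl; congr (_ *: _).
    by rewrite -mulrBl -opprB maxr_pos_neg !mulNr mulrC.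
Qed.

(** Helly's theorem in a flat, given by the linear span U of its lifted points:
    more than k of them are linearly dependent, so [radon] applies.  The flat is
    R ^ d when U is the identity. *)
Lemma helly_flat n (U : 'M[R]_(n, d + 1)) k : (\rank U <= k)%N ->
  helly [set x | (homog x <= U)%MS] k.
Proof.
move=> Uk; apply: helly_critical => T K p cK pU Kp nK.
rewrite leqNgt; apply/negP => kT; apply: nK.
have [Ti|] := pselect (indep (fun t => homog (p t)) [set: T]%SET).
  have /eqP := indep_row_free Ti; have : (\matrix_(k0 < #|[set: T]%SET|)
      homog (p (enum_val k0)) <= U)%MS.
    by apply/row_subP => j; rewrite rowK; apply: pU.
  move=> /mxrankS + TE; rewrite TE cardsT => TU.
  by have := leq_trans kT (leq_trans TU Uk); rewrite ltnn.
move=> /radon[x [P [N [PN xP xN]]]]; exists x.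
  have /inhullE[w [_ _ wx]] := xP; rewrite /= -wx.
  by apply: summx_sub => t _; apply: scalemx_sub; apply: pU.
move=> t; have [tP|tP] := boolP (t \in P).
  apply: (convex_inhull _ _ xN) => // s sN; apply: Kp.
  by apply: contraTneq sN => ->; exact: PN.
apply: (convex_inhull _ _ xP) => // s sP; apply: Kp.
by apply: contraNneq tP => <-.
Qed.

End Helly.

(** * Finite traces of convex sets *)

Section EmptyPolytope.
Variables (R : realType) (d : nat) (E : finType) (e : E -> 'rV[R]_d).
Hypothesis e_inj : injective e.
Implicit Types (A B C : {set E}).

(** Expand each point of B as a combination of p and of points of A, and
    substitute in a representation of p.  The coefficient of p on the right is
    less than 1, since it would otherwise force some point of B to be p; so the
    equation can be solved for p. *)
Lemma anti_exchange (p : E) A B :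
  p \notin B -> (forall c, c \in B -> inhull e (p |: A) (e c)) ->
  inhull e B (e p) -> inhull e (A :\ p) (e p).
Proof.
move=> pB BA [w [w0 wB w1 wp]].
have /choice[m mP] (c : E) : exists m : E -> R, c \in B ->
    [/\ forall i, 0 <= m i, forall i, i \notin p |: A -> m i = 0,
      \sum_i m i = 1 & \sum_i m i *: e i = e c].
  case: (boolP (c \in B)) => [/BA[m mP]|_]; first by exists m.
  by exists (fun=> 0).
have m_lt1 c : c \in B -> m c p < 1.
  move=> cB; have [m0 mA m1 mc] := mP c cB.
  have mp : m c p <= 1 by rewrite -m1 (bigD1 p) //= lerDl sumr_ge0.
  rewrite lt_neqAle mp andbT; apply: contraNN pB => /eqP mp1.
  suff <- : c = p by [].
  apply: e_inj; rewrite -mc (bigD1 p) //= mp1 scale1r big1 ?addr0 // => i ip.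
  have : \sum_(j | j != p) m c j == 0.
    by move: m1; rewrite (bigD1 p) //= mp1 => /(canRL (addKr _)) ->; rewrite addNr.
  rewrite psumr_eq0 => [/allP/(_ i)|k _]; last exact: m0.
  by rewrite mem_index_enum ip => /(_ isT)/eqP ->; rewrite scale0r.
pose s := \sum_(c in B) w c * m c p.
have wB1 : \sum_(c in B) w c = 1.
  by rewrite -w1 [RHS](bigID [in B]) /= [X in _ + X]big1 ?addr0 // => i; apply: wB.
have s1 : 0 < 1 - s.
  rewrite -[X in X - s]wB1 /s -sumrB.
  have [c cB wc] : exists2 c, c \in B & w c != 0.
    apply: contrapT => nc; move: wB1; rewrite big1 => [/esym/eqP|c cB].
      by rewrite oner_eq0.
    by apply: contrapT => /eqP wc; apply: nc; exists c.
  have ge0 i : i \in B -> 0 <= w i - w i * m i p.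
    by move=> iB; rewrite -[X in X - _]mulr1 -mulrBr mulr_ge0 // subr_ge0 ltW ?m_lt1.
  rewrite (bigD1 c) //=; apply: ltr_pwDl; last first.
    by apply: sumr_ge0 => i /andP[iB _]; apply: ge0.
  rewrite -[X in X - _]mulr1 -mulrBr mulr_gt0 ?subr_gt0 ?m_lt1 //.
  by rewrite lt_neqAle eq_sym wc w0.
pose n i := \sum_(c in B) w c * m c i.
have nn : \sum_i n i = 1.
  rewrite /n exchange_big /= -wB1; apply: eq_bigr => c /mP[_ _ m1 _].
  by rewrite -mulr_sumr m1 mulr1.
have np : \sum_i n i *: e i = e p.
  rewrite (eq_bigr (fun i => \sum_(c in B) (w c * m c i) *: e i)); last first.
    by move=> i _; rewrite scaler_suml.
  rewrite exchange_big /= -wp [RHS](bigID [in B]) /= [X in _ + X]big1 ?addr0.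
    apply: eq_bigr => c /mP[_ _ _ <-]; rewrite scaler_sumr.
    by apply: eq_bigr => i _; rewrite scalerA.
  by move=> i /wB ->; rewrite scale0r.
have s1n : 1 - s != 0 by rewrite gt_eqF.
exists (fun i => if i == p then 0 else n i / (1 - s)); split.
- move=> i; case: eqP => // _; rewrite divr_ge0 ?(ltW s1) //.
  by apply: sumr_ge0 => c /mP[m0 _ _ _]; rewrite mulr_ge0.
- move=> i; rewrite in_setD1; case: eqP => //= /eqP ip iA.
  rewrite /n big1 ?mul0r // => c /mP[_ mA _ _].
  by rewrite mA ?mulr0 // in_setU1 negb_or ip.
- rewrite (bigD1 p) //= eqxx add0r.
  rewrite (eq_bigr (fun i => n i / (1 - s))) => [|i /negbTE -> //].
  rewrite -mulr_suml; move: nn; rewrite (bigD1 p) //= => nn.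
  by apply: (mulIf s1n); rewrite divfK // mul1r -nn addrAC subrr add0r.
- rewrite (bigD1 p) //= eqxx scale0r add0r.
  rewrite (eq_bigr (fun i => (1 - s)^-1 *: (n i *: e i))); last first.
    by move=> i /negbTE ->; rewrite scalerA mulrC.
  rewrite -scaler_sumr; apply: (scalerI s1n); rewrite scalerA divff // scale1r.
  by rewrite scalerBl scale1r -[X in X - _]np [in RHS](bigD1 p) //= addrAC subrr add0r.
Qed.

(** A set of points is closed when it is the trace on E of a convex set. *)
Definition trace_closed A : Prop := forall x, inhull e A (e x) -> x \in A.

(** By minimality the closure of p and K is all of C; then [anti_exchange]
    prevents p from being in the hull of the other points of C. *)
Lemma trace_closed_setD1 K C p : trace_closed K -> trace_closed C ->
  K \subset C -> p \in C -> p \notin K ->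
  (forall C', trace_closed C' -> K \proper C' -> (#|C| <= #|C'|)%N) ->
  trace_closed (C :\ p).
Proof.
move=> cK cC KC pC pK Cmin x xC.
rewrite in_setD1 (cC x) ?andbT; last exact: inhull_mono (subD1set _ _) xC.
apply: contraNneq (pK) => xp; rewrite {x}xp in xC.
pose H := [set y | `[< inhull e (p |: K) (e y) >]]%SET.
have HC : H \subset C.
  apply/fintype.subsetP => y; rewrite inE => /asboolP pKy; apply: cC.
  by apply: inhull_mono pKy; rewrite finset.subUset finset.sub1set pC.
have HE : H = C.
  apply/eqP; rewrite finset.eqEcard HC; apply: Cmin.
    move=> y Hy; rewrite inE; apply/asboolP; apply: inhull_trans Hy => i.
    by rewrite inE => /asboolP.
  apply/properP; split.
    apply/fintype.subsetP => y yK; rewrite inE; apply/asboolP.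
    by apply: inhull_point; rewrite in_setU1 yK orbT.
  exists p => //; rewrite inE; apply/asboolP/inhull_point.
  by rewrite setU11.
apply: cK; apply: inhull_mono (subD1set _ p) _.
apply: anti_exchange xC; first by rewrite setD11.
by move=> c; rewrite in_setD1 -HE inE => /andP[_ /asboolP].
Qed.

Lemma eq_midpoint (x y : 'rV[R]_d) : x = 2^-1 *: (x + y) -> x = y.
Proof. by move=> /rowP xy; apply/rowP => k; have := xy k; rewrite !mxE; lra. Qed.

(** Enlarge the sets to a family of closed sets K j of largest total size that
    still has no common point.  A minimal closed set that contains K j properly
    has just one more point, by [trace_closed_setD1]; this point p j lies in
    all the other sets, since otherwise K j could be enlarged.  Hence each K j
    together with p j is closed, and contains all the points p.  A midpoint of
    two of them would lie in all these closed sets; outside some K l, it must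
    be p l, which is impossible. *)
Lemma empty_polytope (J : finType) (K0 : J -> {set E}) :
  (forall j, trace_closed (K0 j)) -> (forall x, exists j, x \notin K0 j) ->
  (forall j, exists x, forall l, l != j -> x \in K0 l) ->
  exists p : J -> E, injective p /\
    forall i j x, i != j -> e x <> 2^-1 *: (e (p i) + e (p j)).
Proof.
move=> cK0 K0n K0p.
pose P (K : {ffun J -> {set E}}) := `[< [/\ forall j, trace_closed (K j),
  forall x, exists j, x \notin K j &
  forall j, exists x, forall l, l != j -> x \in K l] >].
have P0 : P (finfun K0).
  apply/asboolP; split=> [j|x|j]; first by rewrite ffunE.
    by have [j ?] := K0n x; exists j; rewrite ffunE.
  by have [x xK] := K0p j; exists x => l /xK; rewrite ffunE.
have [K /asboolP[cK Kn Kp] Kmax] :=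
  @arg_maxnP _ (finfun K0) P (fun K => \sum_j #|K j|)%N P0.
have Kstep j : exists p, [/\ p \notin K j, forall l, l != j -> p \in K l
    & trace_closed (p |: K j)].
  have [x xK] := Kp j.
  have xj : x \notin K j.
    by have [l xl] := Kn x; have [<-//|/xK xl'] := eqVneq l j; rewrite xl' in xl.
  have KT : `[< trace_closed [set: E]%SET /\ K j \proper [set: E]%SET >].
    apply/asboolP; split=> [y _|]; first by rewrite finset.in_setT.
    by apply/properP; split; [exact: finset.subsetT|exists x => //; rewrite finset.in_setT].
  have [C /asboolP[cC KC] Cmin] := @arg_minnP _ [set: E]%SET
    (fun C : {set E} => `[< trace_closed C /\ K j \proper C >]) (fun C => #|C|) KT.
  have {}Cmin C' : trace_closed C' -> K j \proper C' -> (#|C| <= #|C'|)%N.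
    by move=> cC' KC'; apply: Cmin; apply/asboolP.
  have /properP[KsC [p pC pK]] := KC.
  have CE : C = p |: K j.
    have cCp := trace_closed_setD1 (cK j) cC KsC pC pK Cmin.
    suff <- : C :\ p = K j by rewrite finset.setD1K.
    apply/eqP; rewrite eq_sym finset.eqEproper.
    rewrite subsetD1 KsC pK /=; apply/negP => /(Cmin _ cCp).
    by have := cardsD1 p C; rewrite pC; lia.
  exists p; split=> //; last by rewrite -CE.
  pose K' := [ffun l => if l == j then C else K l].
  have [/existsP[y /forallP yK']|nc] := boolP [exists y, [forall l, y \in K' l]].
    have yp : y = p.
      have := yK' j; rewrite ffunE eqxx CE in_setU1 => /orP[/eqP//|yj].
      have [l yl] := Kn y; have := yK' l; rewrite ffunE; case: eqP => [lj|_].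
        by rewrite lj yj in yl.
      by rewrite (negbTE yl).
    by move=> l lj; have := yK' l; rewrite ffunE (negbTE lj) yp.
  have PK' : P K'.
    apply/asboolP; split=> [l|y|l].
    - by rewrite ffunE; case: eqP.
    - by apply/existsP; rewrite -negb_forall; move/existsPn: nc; apply.
    have [y yK] := Kp l; exists y => k /yK ykK; rewrite ffunE.
    by case: eqP => // kj; rewrite kj in ykK; apply: (fintype.subsetP KsC).
  have : (\sum_l #|K' l| <= \sum_l #|K l|)%N := Kmax _ PK'.
  rewrite leqNgt => /negP[]; rewrite (bigD1 j) //= [ltnRHS](bigD1 j) //= ffunE eqxx.
  rewrite (eq_bigr (fun l => #|K' l|)) => [|l lj]; last by rewrite ffunE (negbTE lj).
  by rewrite ltn_add2r proper_card.
have /choice[p pP] := Kstep.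
exists p; split.
  move=> i j pij; apply: contrapT => /eqP ij.
  by case: (pP i) => _ /(_ j); rewrite eq_sym ij pij => /(_ isT); case: (pP j) => /negbTE ->.
move=> i j x ij xE.
have [l xl] := Kn x.
have half C : p i \in C -> p j \in C -> inhull e C (e x).
  move=> iC jC; rewrite xE scalerDr.
  have -> : 2^-1 *: e (p j) = (1 - 2^-1) *: e (p j) by congr (_ *: _); lra.
  have [h0 h1] : 0 <= 2^-1 :> R /\ 2^-1 <= 1 :> R by split; lra.
  exact: ((convexP _).1 (@convex_inhull_set R d E e C) _ _ _
    (inhull_point e iC) (inhull_point e jC) h0 h1).
have mem k : k != l -> p k \in K l by move=> kl; case: (pP k) => _ + _; apply; rewrite eq_sym.
have memU k : p k \in p l |: K l.
  by rewrite in_setU1; have [->|/mem ->] := eqVneq k l; rewrite ?eqxx ?orbT.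
have xp : x = p l.
  case: (pP l) => _ _ /(_ x (half _ (memU i) (memU j))).
  by rewrite in_setU1 (negbTE xl) orbF => /eqP.
have pij : p i <> p j.
  move=> pij; case: (pP i) => /negP[].
  by rewrite pij; case: (pP j) => _ + _; apply.
have [li|li] := eqVneq i l.
  by apply: pij; apply: e_inj; apply: eq_midpoint; rewrite -xE xp li.
have [lj|lj] := eqVneq j l.
  apply: pij; apply: e_inj; apply/esym/eq_midpoint.
  by rewrite addrC -xE xp lj.
by move/negP: xl; apply; apply: cK; apply: half; apply: mem.
Qed.

End EmptyPolytope.

(** * Discrete sets and lattices *)

Section Lattice.
Variables (R : realType) (d : nat).
Implicit Types (S L : set 'rV[R]_d).

Definition in_box (M : R) (x : 'rV[R]_d) : Prop := forall i, `|x 0 i| <= M.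

Lemma in_box_fin (T : finType) (p : T -> 'rV[R]_d) :
  exists M : R, 0 <= M /\ forall t, in_box M (p t).
Proof.
exists (\sum_t \sum_i `|p t 0 i|); split.
  by apply: sumr_ge0 => t _; apply: sumr_ge0.
move=> t i; rewrite (bigD1 t) //= (bigD1 i) //= -addrA lerDl addr_ge0 //.
  by apply: sumr_ge0.
by apply: sumr_ge0 => s _; apply: sumr_ge0.
Qed.

(** The points given by [helly_critical] lie in a box, which contains finitely
    many points of S, so [empty_polytope] applies to the traces of the convex
    sets on them. *)
Lemma helly_discrete S h :
  (forall M, finite_set [set x | S x /\ in_box M x]) ->
  (forall (J : finType) (p : J -> 'rV[R]_d), (forall j, S (p j)) ->
     (forall i j, i != j -> ~ S (2^-1 *: (p i + p j))) -> (#|J| <= h)%N) ->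
  helly S h.
Proof.
move=> Sfin Sh; apply: helly_critical => T K p cK pS Kp nK.
have [M [M0 pM]] := in_box_fin p.
have [F FE] := finite_fsetP.1 (Sfin M).
have inF (x : 'rV[R]_d) : (x \in F) <-> S x /\ in_box M x.
  by have /predeqP/(_ x) := FE; move=> [h1 h2]; split; [move/h2|move/h1].
pose K0 t := [set x : F | `[< K t (val x) >]]%SET.
have pF t : p t \in F by apply/inF.
have [||t|q [q_inj qmid]] := @empty_polytope R d F val val_inj T K0.
- move=> t x xK; rewrite inE; apply/asboolP; apply: (convex_inhull (cK t) _ xK).
  by move=> y; rewrite inE => /asboolP.
- move=> x; apply: contrapT => nx; apply: nK; exists (val x).
    by have /inF[] := valP x.
  move=> t; apply: contrapT => Kx; apply: nx; exists t.
  by rewrite inE; apply/asboolP.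
- exists [` pF t]%fset => l lt; rewrite inE; apply/asboolP; apply: Kp.
  by rewrite eq_sym.
apply: (Sh _ (fun t => val (q t))) => [t|i j ij Smid].
  by have /inF[] := valP (q t).
have midF : 2^-1 *: (val (q i) + val (q j)) \in F.
  apply/inF; split=> // k.
  have /inF[_ /(_ k) qi] := valP (q i); have /inF[_ /(_ k) qj] := valP (q j).
  rewrite !mxE normrM gtr0_norm; last by lra.
  by have := ler_normD (val (q i) 0 k) (val (q j) 0 k); lra.
exact: (qmid i j [` midF]%fset ij).
Qed.

Variables (L : set 'rV[R]_d) (eps : R).
Hypothesis Lz : zmod_closed [in L].
Hypothesis eps0 : 0 < eps.
Hypothesis Lsep : forall x, L x -> (forall i, `|x 0 i| < eps) -> x = 0.

Let L0 : L 0. Proof. by case: Lz => /set_mem. Qed.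

Let LB x y : L x -> L y -> L (x - y).
Proof. by case: Lz => _ LB Lx Ly; apply/set_mem/LB; apply/mem_set. Qed.

Let LD x y : L x -> L y -> L (x + y).
Proof. by move=> Lx Ly; rewrite -[y]opprK -[- y]add0r; do ?apply: LB. Qed.

(** Divide the box into cells of side eps: two points of L in the same cell
    differ by less than eps in each coordinate. *)
Lemma grid_injective M k : 2 * M / eps < k.+1%:R ->
  exists f : 'rV[R]_d -> {ffun 'I_d -> 'I_k.+1}, forall x y, L x -> L y ->
    in_box M x -> in_box M y -> f x = f y -> x = y.
Proof.
move=> Mk; exists (fun x => [ffun i => inord (Num.truncn ((x 0 i + M) / eps))]).
move=> x y Lx Ly Mx My fxy; apply/eqP; rewrite -subr_eq0; apply/eqP.
apply: Lsep => [|i]; first exact: LB.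
have cell z : in_box M z -> let n := Num.truncn ((z 0 i + M) / eps) in
    [/\ (n < k.+1)%N, n%:R * eps <= z 0 i + M & z 0 i + M < n.+1%:R * eps].
  move=> /(_ i); rewrite ler_norml => /andP[zl zu] n.
  have z0 : 0 <= (z 0 i + M) / eps by apply: divr_ge0; [lra|exact: ltW].
  have /andP[nl nu] := truncn_itv z0.
  rewrite -ler_pdivlMr // -ltr_pdivrMr //; split=> //.
  rewrite -(ltr_nat R); apply: le_lt_trans nl (le_lt_trans _ Mk).
  by rewrite ler_pM2r ?invr_gt0 //; lra.
have [xk xl xu] := cell x Mx; have [yk yl yu] := cell y My.
move/ffunP/(_ i): fxy; rewrite !ffunE => /(congr1 val); rewrite /= !inordK //.
move=> xy; rewrite xy in xl xu; set n := Num.truncn _ in xl xu yl yu.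
rewrite !mxE ltr_norml -!natr1 in xl xu yl yu *.
by apply/andP; split; nra.
Qed.

Lemma finite_box M : finite_set [set x | L x /\ in_box M x].
Proof.
have [k Mk] : exists k, 2 * M / eps < k.+1%:R.
  by exists (Num.truncn (2 * M / eps)); apply: truncnS_gt.
have [f fP] := grid_injective Mk.
set A := [set _ | _]; have fA : {in A &, injective f}.
  by move=> x y /set_mem[Lx Mx] /set_mem[Ly My]; apply: fP.
by rewrite -(eq_finite_set (inj_card_eq fA)); apply: finite_finset.
Qed.

(** Read words over T as binary expansions with digits in T.  Words of length n
    represent distinct points of L in a box of side O(2 ^ n), which contains
    O(2 ^ (n d)) points of L; so #|T| ^ n = O((2 ^ d) ^ n) for all n. *)
Lemma mod2_classes (T : finType) (x : T -> 'rV[R]_d) :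
  (forall t, L (x t)) -> (forall s t, s != t -> ~ L (2^-1 *: (x s - x t))) ->
  (#|T| <= 2 ^ d)%N.
Proof.
move=> Lx incong; have [M [M0 xM]] := in_box_fin x.
pose word (s : seq T) := foldr (fun t a => x t + 2 *: a) 0 s.
have Lw s : L (word s).
  elim: s => //= t s IH; apply: LD => //.
  by rewrite scaler_nat mulr2n; apply: LD.
have Mw s : in_box (M * 2 ^+ size s) (word s).
  move=> i; suff : `|word s 0 i| <= M * (2 ^+ size s - 1) by lra.
  elim: s => [|t s IH] /=; first by rewrite mxE normr0 expr0 subrr mulr0.
  rewrite !mxE exprS.
  have := ler_normD (x t 0 i) (2 * word s 0 i); have := xM t i.
  rewrite normrM ger0_norm //; lra.
have w_inj : forall s1 s2, size s1 = size s2 -> word s1 = word s2 -> s1 = s2.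
  elim=> [|t1 s1 IH] [|t2 s2] //= [s12] w12.
  have t12 : t1 = t2.
    apply: contrapT => /eqP/incong; apply.
    have -> : 2^-1 *: (x t1 - x t2) = word s2 - word s1.
      apply/rowP => k; move/rowP/(_ k): w12; rewrite !mxE; lra.
    exact: LB.
  rewrite -t12 in w12 *; congr (_ :: _); apply: IH => //.
  by apply/rowP => k; move/rowP/(_ k): w12; rewrite !mxE; lra.
pose c := (Num.truncn (2 * M / eps)).+1.
have count n : (#|T| ^ n <= (c * 2 ^ n) ^ d)%N.
  have cn : (c * 2 ^ n).-1.+1 = (c * 2 ^ n)%N by rewrite prednK // muln_gt0 expn_gt0.
  have [|f fP] := @grid_injective (M * 2 ^+ n) (c * 2 ^ n).-1.
    rewrite cn natrM natrX mulrA mulrAC ltr_pM2r ?exprn_gt0 //.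
    exact: truncnS_gt.
  have finj : injective (fun s : n.-tuple T => f (word s)).
    move=> s1 s2 /fP f12; apply: val_inj; apply: w_inj; first by rewrite !size_tuple.
    by apply: f12 => //; [have := Mw s1|have := Mw s2]; rewrite size_tuple.
  have := leq_card _ finj; rewrite card_tuple card_ffun !card_ord.
  by rewrite cn.
rewrite leqNgt; apply/negP => big.
set A := (2 ^ d)%N in big; have A0 : (0 < A)%N by rewrite expn_gt0.
have grow n : (A ^ n * (A + n) <= A.+1 ^ n * A)%N.
  elim: n => [|n IH]; first by rewrite !expn0 addn0.
  rewrite !expnS; have := leq_mul (leqnn A.+1) IH; nia.
(* large enough for the factor (A + n) / A to exceed the constant c ^ d *)
pose n := (c ^ d * A)%N.
have := count n; rewrite expnMn -!expnM [(n * d)%N]mulnC expnM -/A => cn.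
have AcA : (A.+1 ^ n <= c ^ d * A ^ n)%N.
  by apply: leq_trans cn; rewrite leq_exp2r // muln_gt0 expn_gt0 A0.
have := leq_trans (grow n) (leq_mul AcA (leqnn A)).
by rewrite mulnAC -/n [(n * _)%N]mulnC leq_pmul2l ?expn_gt0 ?A0 //; lia.
Qed.

End Lattice.

(** * Helly numbers of mixed-integer spaces and lattice differences *)

Section HellyNumbers.
Variables (R : realType).

Lemma midpointE d (x y : 'rV[R]_d) : 2^-1 *: (x + y) = 2^-1 *: (x - y) + y.
Proof. by apply/rowP => k; rewrite !mxE; lra. Qed.

(** Two points of L congruent modulo 2 L have their midpoint in L. *)
Lemma helly_lattice d (L : set 'rV[R]_d) eps : zmod_closed [in L] -> 0 < eps ->
  (forall x, L x -> (forall i, `|x 0 i| < eps) -> x = 0) -> helly L (2 ^ d).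
Proof.
move=> Lz e0 Lsep; apply: helly_discrete => [M|J p pL pmid].
  exact: (finite_box Lz e0 Lsep).
apply: (mod2_classes Lz e0 Lsep pL) => i j /pmid nL Lij; apply: nL.
have /GRing.zmod_closedD[_ LD] := Lz.
by rewrite midpointE; apply/set_mem/LD; apply/mem_set.
Qed.

(** For a subfamily I of at most a + 1 sets, the s over which these sets have a
    common point form a convex set, and h of these shadows involve at most
    h (a + 1) sets.  A point s of S in all the shadows is one over which every
    a + 1 fibres intersect, and Helly's theorem in R ^ a applies. *)
Lemma helly_mixed n a (S : set 'rV[R]_n) h : helly S h ->
  helly [set x : 'rV[R]_(n + a) | S (lsubmx x)] (h * (a + 1)).
Proof.
move=> Sh T K cK Kh.
pose F (I : {set T}) : set 'rV[R]_n := [set s | (#|I| <= a + 1)%N ->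
  exists y : 'rV[R]_a, forall t, t \in I -> K t (row_mx s y)].
have rowD (s1 s2 : 'rV[R]_n) (y1 y2 : 'rV[R]_a) c :
    row_mx (c *: s1 + (1 - c) *: s2) (c *: y1 + (1 - c) *: y2)
    = c *: row_mx s1 y1 + (1 - c) *: row_mx s2 y2.
  by rewrite !scale_row_mx add_row_mx.
have [s Ss Fs] : exists2 s, S s & forall I, F I s.
  apply: Sh => [I|J Jh].
    apply/convexP => s1 s2 c F1 F2 c0 c1 Ia.
    have [y1 Ky1] := F1 Ia; have [y2 Ky2] := F2 Ia.
    exists (c *: y1 + (1 - c) *: y2) => t tI; rewrite rowD.
    by apply: ((convexP _).1 (cK t)) => //; [exact: Ky1|exact: Ky2].
  pose U := (\bigcup_(I in J | (#|I| <= a + 1)%N) I)%SET.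
  have [|x Sx Kx] := Kh U.
    apply: leq_trans (card_bigcup_le _) _; first by move=> I /andP[_]; apply.
    rewrite leq_mul2r; apply/orP; right; apply: leq_trans Jh.
    by apply: subset_leq_card; apply/fintype.subsetP => I; rewrite inE => /andP[].
  exists (lsubmx x) => // I IJ Ia; exists (rsubmx x) => t tI; rewrite hsubmxK.
  by apply: Kx; apply/bigcupP; exists I; rewrite ?IJ.
have Ra : helly [set x : 'rV[R]_a | (homog x <= (1%:M : 'M[R]_(a + 1)))%MS] (a + 1).
  by apply: helly_flat; rewrite mxrank1.
have [t|I Ia|y _ Ky] := Ra T (fun t => [set y | K t (row_mx s y)]).
- apply/convexP => y1 y2 c K1 K2 c0 c1 /=.
  have -> : s = c *: s + (1 - c) *: s by rewrite -scalerDl addrC subrK scale1r.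
  by rewrite rowD; apply: ((convexP _).1 (cK t)).
- by have [y Ky] := Fs I Ia; exists y => //=; rewrite submx1.
- by exists (row_mx s y) => //=; rewrite row_mxKl.
Qed.

Lemma ramsey33_half (T : finType) (A : {set T}) (x : T) (f g : rel T) :
  (2 < #|A|)%N -> (forall y, y \in A -> f x y) ->
  (forall y z, y \in A -> z \in A -> y != z -> f y z || g y z) ->
  (exists i j k, [/\ f i j, f i k & f j k]) \/
  (exists i j k, [/\ g i j, g i k & g j k]).
Proof.
move=> /card_gt2P[i [j [k [[iA jA kA] [ij jk ki]]]]] fx fg.
have [fij|fij] := boolP (f i j); first by left; exists x, i, j; split=> //; exact: fx.
have [fik|fik] := boolP (f i k); first by left; exists x, i, k; split=> //; exact: fx.
have [fjk|fjk] := boolP (f j k); first by left; exists x, j, k; split=> //; exact: fx.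
right; exists i, j, k; have := fg i j iA jA ij; have := fg j k jA kA jk.
rewrite (negbTE fij) (negbTE fjk) /= => -> ->; split=> //.
by have := fg i k iA kA; rewrite eq_sym (negbTE fik) => /(_ ki).
Qed.

(** Three of the other vertices are joined to a given vertex in one colour, and
    [ramsey33_half] finds a triangle among these four. *)
Lemma ramsey33 (T : finType) (C : {set T}) (f g : rel T) : (5 < #|C|)%N ->
  (forall y z, y \in C -> z \in C -> y != z -> f y z || g y z) ->
  (exists i j k, [/\ f i j, f i k & f j k]) \/
  (exists i j k, [/\ g i j, g i k & g j k]).
Proof.
move=> C5 fg; have [x xC] : exists x, x \in C.
  by apply/set0Pn; rewrite -card_gt0; lia.
pose A := [set y in C :\ x | f x y]; pose B := [set y in C :\ x | ~~ f x y].
have AB : (#|A| + #|B|)%N = #|C|.-1.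
  have -> : #|C|.-1 = #|C :\ x| by rewrite (cardsD1 x) xC.
  rewrite -(cardsID [set y | f x y]%SET (C :\ x)).
  have <- : A = (C :\ x) :&: [set y | f x y]%SET by apply/finset.setP => y; rewrite !inE.
  by have <- : B = (C :\ x) :\: [set y | f x y]%SET by apply/finset.setP => y; rewrite !inE andbC.
have [A2|A2] := ltnP 2 #|A|.
  apply: (@ramsey33_half _ A x) => // [y|y z]; rewrite !inE.
    by move=> /andP[].
  by move=> /andP[/andP[_ yC] _] /andP[/andP[_ zC] _]; apply: fg.
apply/or_comm; apply: (@ramsey33_half _ B x) => [|y|y z]; rewrite ?inE; first lia.
  move=> /andP[/andP[yx yC] fxy]; have := fg x y xC yC; rewrite eq_sym yx.
  by rewrite (negbTE fxy) => /(_ isT).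
move=> /andP[/andP[_ yC] _] /andP[/andP[_ zC] _] yz.
by rewrite orbC; apply: fg.
Qed.

(** A largest set of pairwise incongruent indices has at most 2 ^ d elements and
    meets every congruence class. *)
Lemma congruence_class d (L : set 'rV[R]_d) eps (J : finType) (p : J -> 'rV[R]_d) h :
  zmod_closed [in L] -> 0 < eps ->
  (forall x, L x -> (forall i, `|x 0 i| < eps) -> x = 0) ->
  (forall j, L (p j)) -> (h * 2 ^ d < #|J|)%N ->
  exists C : {set J}, (h < #|C|)%N /\
    forall i j, i \in C -> j \in C -> L (2^-1 *: (p i - p j)).
Proof.
move=> Lz e0 Lsep pL Jh; have [_ LB] := Lz.
pose P (A : {set J}) := [forall i in A, forall j in A, (i != j) ==>
   ~~ `[< L (2^-1 *: (p i - p j)) >]].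
have P0 : P finset.set0 by apply/forall_inP => i; rewrite finset.in_set0.
have [A /forall_inP PA Amax] := @arg_maxnP _ finset.set0 P (fun A => #|A|) P0.
have Ad : (#|A| <= 2 ^ d)%N.
  have <- : #|{: {j | j \in A}}| = #|A| by rewrite card_sig.
  apply: (mod2_classes (x := fun j : {j | j \in A} => p (val j)) Lz e0 Lsep) => [j|i j ij].
    exact: pL.
  have /forall_inP/(_ _ (valP j)) := PA _ (valP i).
  by rewrite (inj_eq val_inj) ij => /asboolPn.
pose C i := [set j | `[< L (2^-1 *: (p j - p i)) >]]%SET.
have Acov : [set: J]%SET = (\bigcup_(i in A) C i)%SET.
  apply/esym/eqP; rewrite -finset.subTset; apply/fintype.subsetP => j _.
  have [jA|jA] := boolP (j \in A).
    apply/bigcupP; exists j => //; rewrite inE; apply/asboolP.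
    by rewrite subrr scaler0; case: Lz => /set_mem.
  apply: contrapT => /negP nj.
  have nC i : i \in A -> j \notin C i.
    by move=> iA; apply: contra nj => jC; apply/bigcupP; exists i.
  have LN i k : L (2^-1 *: (p i - p k)) -> L (2^-1 *: (p k - p i)).
    move=> Lik; rewrite -opprB scalerN; apply/set_mem.
    by have /GRing.zmod_closedN := Lz; apply; apply/mem_set.
  have /Amax : P (j |: A).
    apply/forall_inP => i; rewrite in_setU1 => /orP[/eqP->|iA];
      apply/forall_inP => k; rewrite in_setU1 => /orP[/eqP->|kA]; apply/implyP => ik.
    + by rewrite eqxx in ik.
    + by have := nC k kA; rewrite inE.
    + by have := nC i iA; rewrite inE; apply: contra => /asboolP/LN/asboolP.
    + by have /forall_inP/(_ k kA) := PA i iA; rewrite ik.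
  by rewrite /geq /= cardsU1 jA; lia.
have [i iA Ci] : exists2 i, i \in A & (h < #|C i|)%N.
  apply: contrapT => nC; have : (#|[set: J]%SET| <= #|A| * h)%N.
    rewrite Acov; apply: card_bigcup_le => i iA.
    by rewrite leqNgt; apply/negP => Ch; apply: nC; exists i.
  by rewrite cardsT; have := leq_mul Ad (leqnn h); lia.
exists (C i); split=> // j k; rewrite !finset.in_set => /asboolP Lj /asboolP Lk.
have -> : 2^-1 *: (p j - p k) = 2^-1 *: (p j - p i) - 2^-1 *: (p k - p i).
  by apply/rowP => l; rewrite !mxE; lra.
by apply/set_mem/LB; apply/mem_set.
Qed.

(** Among seven congruent points each midpoint is in L, hence in L' or L''.  For
    a triangle with its midpoints in L', the vertex p i equals
    (p i + p j) / 2 + (p i + p k) / 2 - (p j + p k) / 2, and is in L'. *)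
Lemma helly_lattice_diff d (L L' L'' : set 'rV[R]_d) eps :
  zmod_closed [in L] -> 0 < eps ->
  (forall x, L x -> (forall i, `|x 0 i| < eps) -> x = 0) ->
  zmod_closed [in L'] -> zmod_closed [in L''] ->
  helly (L `\` (L' `|` L'')) (6 * 2 ^ d).
Proof.
move=> Lz e0 Lsep L'z L''z; apply: helly_discrete => [M|J p pS pmid].
  apply: sub_finite_set (finite_box Lz e0 Lsep M).
  by move=> x [[Lx _] Mx].
rewrite leqNgt; apply/negP => Jbig.
have pL j : L (p j) by case: (pS j).
have [C [C6 CL]] := congruence_class Lz e0 Lsep pL Jbig.
pose mid (S : set 'rV[R]_d) : rel J := fun i j => `[< S (2^-1 *: (p i + p j)) >].
have tri (S : set 'rV[R]_d) i j k : zmod_closed [in S] ->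
    mid S i j -> mid S i k -> mid S j k -> S (p i).
  move=> Sz /asboolP Sij /asboolP Sik /asboolP Sjk.
  have [_ SB] := Sz; have /GRing.zmod_closedD[_ SD] := Sz.
  have -> : p i = 2^-1 *: (p i + p j) + (2^-1 *: (p i + p k) - 2^-1 *: (p j + p k)).
    by apply/rowP => l; rewrite !mxE; lra.
  by apply/set_mem/SD; [exact/mem_set|apply/SB; exact/mem_set].
have [||[i [j [k [ij ik jk]]]]|[i [j [k [ij ik jk]]]]] :=
  @ramsey33 J C (mid L') (mid L'').
- exact: leq_trans C6.
- move=> i j iC jC ij; apply: contrapT => /negP; rewrite negb_or.
  move=> /andP[/asboolP n' /asboolP n''].
  apply: (pmid i j ij); split; last by case.
  have /GRing.zmod_closedD[_ LD] := Lz.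
  rewrite midpointE; apply/set_mem/LD; apply/mem_set => //.
  exact: CL.
- by case: (pS i) => _; apply; left; apply: (tri L' i j k).
- by case: (pS i) => _; apply; right; apply: (tri L'' i j k).
Qed.

End HellyNumbers.

(** * Rational combinations near a relative interior point *)

Section RationalCentre.
Variable R : realType.

Lemma finite_positive_lower_bound (T : finType) (f : T -> R) :
  (forall t, 0 < f t) -> exists2 e, 0 < e & forall t, e <= f t.
Proof.
move=> f0; have f0' t : 0 <= (f t)^-1 by rewrite invr_ge0 ltW.
have s0 : 0 < 1 + \sum_t (f t)^-1 by rewrite ltr_pwDl // sumr_ge0.
exists (1 + \sum_t (f t)^-1)^-1; first by rewrite invr_gt0.
move=> t; rewrite -[leRHS]invrK lef_pV2 ?posrE ?invr_gt0 //.
by rewrite (bigD1 t) //= addrCA lerDl addr_ge0 // sumr_ge0.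
Qed.

(** Slightly increase the coefficients l i to rational ones.  The resulting
    perturbation of the point, rewritten on the vectors indexed by B, changes
    each positive coefficient u B b by a small amount, so it stays positive. *)
Lemma rational_in_cones n (I : finType) (h : I -> 'rV[R]_n) (Y : {set I})
    (G : pred {set I}) (u : {set I} -> I -> R) (l : I -> R) :
  (forall B i, G B -> i \in Y -> exists m : I -> R,
     (forall b, b \notin B -> m b = 0) /\ h i = \sum_b m b *: h b) ->
  (forall B b, G B -> b \in B -> 0 < u B b) -> (forall i, i \in Y -> 0 < l i) ->
  (forall B, G B -> \sum_(b in B) u B b *: h b = \sum_(i in Y) l i *: h i) ->
  exists c : I -> rat, [/\ forall i, i \in Y -> 0 < c i,
    forall i, i \notin Y -> c i = 0
    & forall B, G B -> incone h B (\sum_i ratr (c i) *: h i)].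
Proof.
move=> hB u0 l0 ul.
have /choice[m mP] (x : {set I} * I) : exists m : I -> R, G x.1 -> x.2 \in Y ->
    (forall b, b \notin x.1 -> m b = 0) /\ h x.2 = \sum_b m b *: h b.
  have [Gx|] := boolP (G x.1); last by exists (fun=> 0).
  have [Yx|] := boolP (x.2 \in Y); last by exists (fun=> 0).
  by have [m mP] := hB _ _ Gx Yx; exists m.
pose t (x : {set I} * I) := 1 + \sum_(i in Y) `|m (x.1, i) x.2|.
have t0 x : 0 < t x by rewrite ltr_pwDl // sumr_ge0.
have [|e e0 eP] := @finite_positive_lower_bound _ (fun x : {set I} * I =>
    if G x.1 && (x.2 \in x.1) then u x.1 x.2 / t x else 1).
  by move=> x; case: ifP => // /andP[Gx xx]; rewrite divr_gt0 // u0.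
have /choice[c cP] (i : I) : exists c : rat,
    if i \in Y then l i < ratr c :> R /\ ratr c < l i + e else c = 0.
  have [iY|iY] := boolP (i \in Y); last by exists 0.
  have [|c] := @rat_in_itvoo R (l i) (l i + e); first by rewrite ltrDl.
  by rewrite in_itv /= => /andP[? ?]; exists c.
have cY i : i \in Y -> l i < ratr (c i) :> R /\ ratr (c i) < l i + e.
  by move=> iY; have := cP i; rewrite iY.
have cN i : i \notin Y -> c i = 0.
  by move=> /negbTE iY; have := cP i; rewrite iY.
exists c; split=> // [i iY|B GB].
  by rewrite -(ltr0q R); have [li _] := cY i iY; apply: lt_trans li; apply: l0.
pose dl i : R := ratr (c i) - l i.
pose w b := if b \in B then u B b + \sum_(i in Y) dl i * m (B, i) b else 0.
exists w; split.
- move=> b; rewrite /w; case: ifP => // bB.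
  have := eP (B, b); rewrite /= GB bB /= ler_pdivlMr ?t0 // => et.
  suff : `|\sum_(i in Y) dl i * m (B, i) b| <= e * t (B, b).
    by rewrite ler_norml => /andP[+ _]; lra.
  apply: le_trans (ler_norm_sum _ _ _) _.
  rewrite /t mulrDr mulr1 mulr_sumr; apply: ler_wpDl; first exact: ltW.
  apply: ler_sum => i iY; rewrite normrM ler_wpM2r // /dl.
  by have [? ?] := cY i iY; rewrite ger0_norm; lra.
- by move=> b /negbTE bB; rewrite /w bB.
- have -> : \sum_i ratr (c i) *: h i
      = \sum_(i in Y) l i *: h i + \sum_(i in Y) dl i *: h i.
    rewrite (bigID [in Y]) /= [X in _ + X]big1 ?addr0; last first.
      by move=> i /cN ->; rewrite rmorph0 scale0r.
    rewrite -big_split /=; apply: eq_bigr => i _.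
    by rewrite -scalerDl addrC subrK.
  rewrite -(ul B GB).
  have -> : \sum_(i in Y) dl i *: h i
      = \sum_(b in B) (\sum_(i in Y) dl i * m (B, i) b) *: h b.
    under [RHS]eq_bigr do rewrite scaler_suml.
    rewrite exchange_big /=; apply: eq_bigr => i iY.
    have [mB hi] := mP (B, i) GB iY; rewrite [h i]hi scaler_sumr /=.
    rewrite (bigID [in B]) /= [X in _ + X]big1 ?addr0.
      by apply: eq_bigr => b _; rewrite scalerA.
    by move=> b /mB ->; rewrite scale0r scaler0.
  rewrite -big_split /= (bigID [in B]) /= [X in _ + X]big1 ?addr0.
    by apply: eq_bigr => b bB; rewrite /w bB scalerDl.
  by move=> b /negbTE bB; rewrite /w bB scale0r.
Qed.

(** Independent functionals on the row space of M cut out a subspace whose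
    codimension is their number. *)
Lemma rank_common_kernel n m m' (T : finType) (M : 'M[R]_(m, n)) (N : 'M[R]_(m', n))
    (w : T -> 'cV[R]_n) (A : {set T}) :
  indep (fun t => (M *m w t)^T) A -> (N <= M)%MS ->
  (forall t, t \in A -> N *m w t = 0) -> (\rank N + #|A| <= \rank M)%N.
Proof.
move=> /indep_row_free/eqP Ai NM Nw.
pose W := \matrix_(i < n, k < #|A|) w (enum_val k) i 0.
have Wcol k : col k W = w (enum_val k).
  by apply/colP => i; rewrite !mxE.
have MW : (\rank (M *m W) = #|A|)%N.
  rewrite -[RHS]Ai -mxrank_tr; congr (\rank _); apply/row_matrixP => k.
  by rewrite rowK -tr_col -Wcol !colE mulmxA.
have NW : N *m W = 0.
  apply/matrixP => i k; have := Nw _ (enum_valP k).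
  by rewrite -Wcol colE mulmxA -colE => /colP/(_ i); rewrite [LHS]mxE => ->; rewrite !mxE.
rewrite -(mxrank_mul_ker M W) MW addnC leq_add2l; apply: mxrankS.
by rewrite sub_capmx NM; apply/sub_kermxP.
Qed.

Variables (d : nat) (I : finType) (v : I -> 'rV[R]_d).
Implicit Types Y B : {set I}.

Definition aff_span Y : 'M[R]_(d + 1) := (\sum_(i in Y) <<homog (v i)>>)%MS.

Lemma aff_span_mem Y i : i \in Y -> (homog (v i) <= aff_span Y)%MS.
Proof. by move=> iY; rewrite (sumsmx_sup i) // genmxE. Qed.

Lemma aff_span_sub Y n (M : 'M[R]_(n, d + 1)) :
  (forall i, i \in Y -> (homog (v i) <= M)%MS) -> (aff_span Y <= M)%MS.
Proof. by move=> YM; apply/sumsmx_subP => i iY; rewrite genmxE; apply: YM. Qed.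

Lemma aff_span_comb Y (z : 'rV[R]_(d + 1)) : (z <= aff_span Y)%MS ->
  exists m : I -> R, (forall i, i \notin Y -> m i = 0) /\
    z = \sum_i m i *: homog (v i).
Proof.
move=> /sub_sumsmxP[a ->].
have /choice[m mP] (i : I) : exists c, a i *m <<homog (v i)>>%MS = c *: homog (v i).
  by apply/sub_rVP; rewrite (submx_trans (submxMl _ _)) // genmxE.
exists (fun i => if i \in Y then m i else 0); split=> [i /negbTE -> //|].
rewrite big_mkcond /=; apply: eq_bigr => i _; case: ifP => // _.
by rewrite scale0r.
Qed.

Lemma homog_rank (x : 'rV[R]_d) : \rank (homog x) = 1%N.
Proof.
apply/eqP; rewrite eqn_leq rank_leq_row lt0n mxrank_eq0.
apply/eqP => x0; have := homog_wt x; rewrite x0 mul0mx => /matrixP/(_ 0 0).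
by rewrite !mxE /= => /eqP; rewrite eq_sym oner_eq0.
Qed.

Lemma rank1_homog n (N : 'M[R]_(n, d + 1)) (x y : 'rV[R]_d) : (\rank N <= 1)%N ->
  (homog x <= N)%MS -> (homog y <= N)%MS -> x = y.
Proof.
move=> N1 xN yN; have Ny : (N <= homog y)%MS.
  by have [_ <-] := mxrank_leqif_sup yN; rewrite eqn_leq mxrankS //= homog_rank.
have /sub_rVP[a xa] := submx_trans xN Ny.
have a1 : a = 1.
  have := homog_wt x; rewrite xa -scalemxAl homog_wt => /matrixP/(_ 0 0).
  by rewrite !mxE /= mulr1.
by apply: homog_inj; rewrite xa a1 scale1r.
Qed.

Definition big_in q Y B := (B \subset Y) && (#|Y :\: B| <= q)%N.

Definition has_rational_centre q Y : Prop :=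
  exists c : I -> rat, [/\ forall i, i \notin Y -> c i = 0, \sum_i c i = 1
    & forall B, big_in q Y B -> inhull v B (\sum_i ratr (c i) *: v i)].

Lemma has_rational_centreS q Y Y' : Y' \subset Y ->
  has_rational_centre q Y' -> has_rational_centre q Y.
Proof.
move=> YY' [c [cY c1 cB]]; exists c; split=> // [i iY|B /andP[BY Bq]].
  by apply: cY; apply: contra iY; apply: (fintype.subsetP YY').
apply: (@inhull_mono _ _ _ _ (B :&: Y')); first exact: subsetIl.
apply: cB; rewrite /big_in subsetIr /=; apply: leq_trans Bq.
apply: subset_leq_card; apply/fintype.subsetP => i; rewrite !inE.
by move=> /andP[+ iY']; rewrite iY' andbT (fintype.subsetP YY') // andbT.
Qed.

Lemma rational_centre_vertex q Y x i : i \in Y -> v i = x ->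
  (forall B, big_in q Y B -> inhull v B x) -> has_rational_centre q Y.
Proof.
move=> iY <- xB; exists (fun j => (j == i)%:R); split.
- by move=> j; case: eqP => // ->; rewrite iY.
- by rewrite (bigD1 i) //= eqxx big1 ?addr0 // => j /negbTE ->.
- move=> B /xB; congr (inhull v B _).
  rewrite (bigD1 i) //= eqxx rmorph1 scale1r big1 ?addr0 // => j /negbTE ->.
  by rewrite rmorph0 scale0r.
Qed.

(** The hypothesis on u says that some positive multiple of a point is a
    combination with positive coefficients of each large subfamily, so this
    point is interior to all the hulls relative to the affine span of Y. *)
Lemma rational_centre_interior q Y (u : {set I} -> I -> R) :
  (0 < #|Y|)%N ->
  (forall B, big_in q Y B -> (aff_span Y <= aff_span B)%MS) ->
  (forall B b, 0 < u B b) ->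
  (forall B, big_in q Y B -> \sum_(b in B) u B b *: homog (v b)
      = \sum_(b in Y) u Y b *: homog (v b)) ->
  has_rational_centre q Y.
Proof.
move=> Y0 YB u0 uB.
have [B i /YB YsB iY|B b _ _|i _|B /uB //|c [c0 cN cB]] := @rational_in_cones _ I
  (fun i => homog (v i)) Y (big_in q Y) u (u Y).
- exact: aff_span_comb (submx_trans (aff_span_mem iY) YsB).
- exact: u0.
- exact: u0.
have s0 : 0 < \sum_i c i.
  have /card_gt0P[i iY] := Y0.
  rewrite (bigD1 i) //= ltr_pwDl ?c0 // sumr_ge0 // => j _.
  by have [/c0/ltW|/cN->] := boolP (j \in Y).
set s := \sum_i c i in s0.
have c1 : \sum_i c i / s = 1 by rewrite -mulr_suml divff // gt_eqF.
exists (fun i => c i / s); split=> // [i /cN->|B /cB]; first by rewrite mul0r.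
case=> w [w0 wB wz]; apply/inhullE.
have rs0 : 0 < ratr s :> R by rewrite ltr0q.
exists (fun i => w i / ratr s); split.
- by move=> i; rewrite divr_ge0 // ltW.
- by move=> i /wB ->; rewrite mul0r.
have -> : homog (\sum_i ratr (c i / s) *: v i)
    = \sum_i ratr (c i / s) *: homog (v i) :> 'rV[R]_(d + 1).
  by rewrite sum_homog -rmorph_sum /= c1 rmorph1.
transitivity ((ratr s)^-1 *: \sum_i w i *: homog (v i) : 'rV[R]_(d + 1)).
  by rewrite scaler_sumr; apply: eq_bigr => i _; rewrite scalerA mulrC.
rewrite wz scaler_sumr; apply: eq_bigr => i _.
by rewrite scalerA mulrC fmorph_div.
Qed.

End RationalCentre.

(** * Centres with rational coordinates *)

Section RationalModule.
Variables (R : realType) (d : nat) (I : finType) (v : I -> 'rV[R]_d).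
Implicit Types Y B : {set I}.

(** This is [stiemke] for the functionals w |-> w B (v b), indexed by the pairs
    (B, b) with b in a large subfamily B, on the space of families w of affine
    functionals with sum 0.  Testing a relation between them on the families
    supported by B and Y gives the equality of the two combinations. *)
Lemma interior_or_balanced q Y :
  (exists u : {set I} -> I -> R, (forall B b, 0 < u B b) /\
     forall B, big_in q Y B -> \sum_(b in B) u B b *: homog (v b)
      = \sum_(b in Y) u Y b *: homog (v b)) \/
  (exists w : {set I} -> 'cV[R]_(d + 1), [/\ forall B, ~~ big_in q Y B -> w B = 0,
     \sum_B w B = 0,
     forall B b, big_in q Y B -> b \in B -> 0 <= (homog (v b) *m w B) 0 0
     & exists B b, [/\ big_in q Y B, b \in B & 0 < (homog (v b) *m w B) 0 0]]).
Proof.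
pose V : lmodType R := {ffun {set I} -> 'cV[R]_(d + 1)}.
pose W (f : V) := (forall B, ~~ big_in q Y B -> f B = 0) /\ \sum_B f B = 0.
pose a (x : {set I} * I) (f : V) : R :=
  if big_in q Y x.1 && (x.2 \in x.1) then (homog (v x.2) *m f x.1) 0 0 else 0.
have aL x c (f g : V) : a x (c *: f + g) = c * a x f + a x g.
  rewrite /a; case: ifP => _; last by rewrite mulr0 addr0.
  by rewrite !ffunE dot_linear.
have W0 : W 0 by split=> [B _|]; [rewrite ffunE|rewrite big1 // => B _; rewrite ffunE].
have WP c (f g : V) : W f -> W g -> W (c *: f + g).
  move=> [fN fs] [gN gs]; split=> [B nB|].
    by rewrite !ffunE fN // gN // scaler0 addr0.
  under eq_bigr do rewrite !ffunE.
  by rewrite big_split /= -scaler_sumr fs gs scaler0 addr0.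
have [Wa|] := pselect (forall f, W f -> (forall x, 0 <= a x f) -> forall x, a x f = 0);
  last first.
  move=> /existsNP[f /not_implyP[[fN fs] /not_implyP[f0 /existsNP[[B b] fBb]]]].
  have := f0 (B, b); move: fBb; rewrite /a /=; case: ifP => // /andP[BY bB] fBb fge.
  right; exists f; split=> // [C c CY cC|].
    by have := f0 (C, c); rewrite /a /= CY cC.
  exists B, b; split=> //; rewrite lt_neqAle fge andbT.
  by apply/eqP => fz; apply: fBb.
have [u [u0 ua]] := stiemke W0 WP aL Wa.
left; exists (fun B b => u (B, b)); split=> [B b|B BY]; first exact: u0.
have YY : big_in q Y Y by rewrite /big_in fintype.subxx finset.setDv cards0.
have [->//|neqBY] := eqVneq B Y.
apply: eq_row_dot => g.
pose D C : V := [ffun C' => if C' == C then g else 0].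
have WD : W ((-1) *: D Y + D B).
  split=> [C nC|].
    rewrite !ffunE; case: eqP => [CY|_]; first by rewrite CY YY in nC.
    by case: eqP => [CB|_]; [rewrite CB BY in nC|rewrite scaler0 addr0].
  under eq_bigr do rewrite !ffunE.
  rewrite big_split /= -scaler_sumr (bigD1 Y) //= eqxx big1 ?addr0; last first.
    by move=> C /negbTE ->.
  rewrite (bigD1 B) //= eqxx big1 ?addr0; last by move=> C /negbTE ->.
  by rewrite scaleN1r addNr.
have aD C : big_in q Y C -> \sum_x u x * a x (D C)
    = ((\sum_(b in C) u (C, b) *: homog (v b)) *m g) 0 0.
  move=> CY; rewrite [in RHS]big_mkcond /=.
  have -> : \sum_b (if b \in C then u (C, b) *: homog (v b) else 0)
      = \sum_b (if b \in C then u (C, b) else 0) *: homog (v b).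
    by apply: eq_bigr => b _; case: ifP; rewrite ?scale0r.
  rewrite dot_sum; transitivity (\sum_C' \sum_b u (C', b) * a (C', b) (D C)).
    by rewrite pair_bigA; apply: eq_bigr => -[].
  rewrite (bigD1 C) //= [X in _ + X]big1 ?addr0.
    apply: eq_bigr => b _; rewrite /a /= CY ffunE eqxx /=.
    by case: ifP; rewrite ?mul0r ?mulr0.
  move=> C' /negbTE C'C; rewrite big1 // => b _; rewrite /a /= ffunE C'C mulmx0 mxE.
  by rewrite if_same mulr0.
have := ua _ WD; under eq_bigr do rewrite aL mulN1r mulrDr mulrN.
by rewrite big_split /= sumrN !aD // addrC => /subr0_eq.
Qed.

(** The second term of the maximum is there for k = 0, and for Helly's theorem
    in the affine span of Y to provide a real centre x.  If some large B spans
    less, pass to B; otherwise use [interior_or_balanced].  In the balanced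
    case, g B0 is a negative combination of independent g B, for B in A, and F
    is the set of the points where they all vanish.  These functionals are
    nonnegative at x, so they vanish there too: this bounds #|A| by k, and when
    #|A| = k the common zero set in the span is the single point x, which is
    then one of the given points. *)
Lemma rational_centre q k Y : (\rank (aff_span v Y) <= k.+1)%N ->
  (maxn (2 * k) (k + 1) * q < #|Y|)%N -> has_rational_centre v q Y.
Proof.
elim/ltn_ind: k Y => k IH Y rkY Ybig.
have Y0 : (0 < #|Y|)%N by lia.
have maxl : (2 * k * q <= maxn (2 * k) (k + 1) * q)%N by rewrite leq_mul2r leq_maxl orbT.
have maxr : ((k + 1) * q <= maxn (2 * k) (k + 1) * q)%N by rewrite leq_mul2r leq_maxr orbT.
have shrink Y' k' : (k' < k)%N -> Y' \subset Y -> (\rank (aff_span v Y') <= k'.+1)%N ->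
    (2 * k' * q < #|Y'|)%N -> ((k' + 1) * q < #|Y'|)%N -> has_rational_centre v q Y.
  move=> k'k Y'Y rk Y'l Y'r; apply: has_rational_centreS Y'Y _.
  by apply: (IH k') => //; rewrite maxnMl gtn_max Y'l Y'r.
have [x xY xB] : exists2 x, (homog x <= aff_span v Y)%MS &
    forall B, big_in q Y B -> inhull v B x.
  have [i iY||x xY xB] := @helly_centre R d _ k.+1 I v Y q (@helly_flat R d _ (aff_span v Y) _ rkY).
  - exact: aff_span_mem.
  - by rewrite -[k.+1]addn1; apply: leq_ltn_trans maxr Ybig.
  by exists x => // B /andP[]; apply: xB.
have [[B [BY Brk]]|full] := pselect (exists B, big_in q Y B /\
    ~~ (aff_span v Y <= aff_span v B)%MS).
  have /andP[BsY Bq] := BY.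
  have BYs : (aff_span v B <= aff_span v Y)%MS.
    by apply: aff_span_sub => i iB; apply/aff_span_mem/(fintype.subsetP BsY).
  have rkB : (\rank (aff_span v B) < \rank (aff_span v Y))%N.
    by rewrite ltn_neqAle mxrankS // andbT (mxrank_leqif_sup BYs).
  have cB : (#|Y| = #|B| + #|Y :\: B|)%N.
    by rewrite -(cardsID B Y) (finset.setIidPr BsY).
  have [b bB] : exists b, b \in B by apply/set0Pn; rewrite -card_gt0; lia.
  have rk1 : (0 < \rank (aff_span v B))%N.
    by have := mxrankS (aff_span_mem v bB); rewrite homog_rank.
  by apply: (shrink B k.-1) => //; nia.
have {}full B : big_in q Y B -> (aff_span v Y <= aff_span v B)%MS.
  by move=> BY; apply: contrapT => /negP nB; apply: full; exists B.
have [[u [u0 uB]]|[w [wN ws wge [B0 [b0 [B0Y bB0 wb0]]]]]] := interior_or_balanced q Y.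
  exact: rational_centre_interior uB.
pose M := aff_span v Y.
pose g (B : {set I}) := (M *m w B)^T.
have gsum : \sum_B g B = 0.
  by rewrite /g -raddf_sum -mulmx_sumr ws mulmx0 raddf0.
have : incone g [set~ B0] (- g B0).
  exists (fun B => (B != B0)%:R); split=> [B|B|].
  - exact: ler0n.
  - by rewrite finset.in_setC1 negbK => /eqP ->; rewrite eqxx.
  - rewrite (bigD1 B0) //= eqxx scale0r add0r; move: gsum; rewrite (bigD1 B0) //=.
    move=> /(canRL (addKr _)); rewrite addr0 => <-.
    by apply: eq_bigr => B ->; rewrite scale1r.
move=> /caratheodory[A [c [_ Ai c0 cN cg]]].
have gM n (z : 'M[R]_(n, d + 1)) : (z <= M)%MS ->
    z *m w B0 + \sum_B c B *: (z *m w B) = 0.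
  move=> /submxP[D ->]; rewrite -!mulmxA.
  have -> : \sum_B c B *: (D *m M *m w B) = D *m (\sum_B c B *: g B)^T.
    rewrite raddf_sum mulmx_sumr; apply: eq_bigr => B _.
    rewrite /=; have -> : (c B *: g B)^T = c B *: (M *m w B) by apply/matrixP => i j; rewrite !mxE.
    by rewrite -scalemxAr mulmxA.
  by rewrite cg raddfN /= trmxK mulmxN addrN.
have gb0 : g B0 != 0.
  apply: contraTneq wb0 => /(congr1 trmx); rewrite trmxK trmx0 => Mw.
  have /submxP[D ->] := aff_span_mem v (fintype.subsetP (andP B0Y).1 _ bB0).
  by rewrite -mulmxA -/M Mw mulmx0 mxE ltxx.
have A0 : (0 < #|A|)%N.
  rewrite card_gt0; apply: contra_neq gb0 => A0.
  apply/eqP; rewrite -oppr_eq0 -cg big1 // => B _.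
  by rewrite cN ?scale0r // A0 finset.in_set0.
have Abig B : B \in A -> big_in q Y B.
  move=> BA; apply: contrapT => /negP /wN wB.
  have gB : g B = 0 by rewrite /g wB mulmx0 trmx0.
  have := Ai (fun C => (C == B)%:R).
  have h1 : forall C, C \notin A -> (C == B)%:R = 0 :> R.
    by move=> C; case: eqP => // ->; rewrite BA.
  move=> /(_ h1) {h1}; rewrite (bigD1 B) //= eqxx scale1r gB big1 ?addr0; last first.
    by move=> C /negbTE ->; rewrite scale0r.
  by move=> /(_ erefl B)/eqP; rewrite eqxx oner_eq0.
(* a positive combination of these functionals is zero on M, so they vanish
   wherever all of them are nonnegative *)
have vanish (z : 'rV[R]_(d + 1)) : (z <= M)%MS -> 0 <= (z *m w B0) 0 0 ->
    (forall B, B \in A -> 0 <= (z *m w B) 0 0) -> forall B, B \in A -> z *m w B = 0.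
  move=> zM z0 zA B BA; apply/rowP => j; rewrite [j]ord1 [RHS]mxE.
  have ge0 C : 0 <= c C * (z *m w C) 0 0.
    have [CA|/cN->] := boolP (C \in A); last by rewrite mul0r.
    by rewrite mulr_ge0 ?zA // ltW // c0.
  have zs : \sum_C c C * (z *m w C) 0 0 <= 0.
    have -> : \sum_C c C * (z *m w C) 0 0 = (\sum_C c C *: (z *m w C)) 0 0.
      by rewrite summxE; apply: eq_bigr => C _; rewrite [RHS]mxE.
    move/(canRL (addKr _)): (gM _ z zM) => ->; rewrite addr0.
    by rewrite mxE oppr_le0.
  have : c B * (z *m w B) 0 0 <= 0.
    by apply: le_trans zs; rewrite (bigD1 B) //= lerDl sumr_ge0.
  by rewrite pmulr_rle0 ?c0 // => zB; apply/eqP; rewrite eq_le zB zA.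
have x0 B : B \in A -> homog x *m w B = 0.
  have xge B' : big_in q Y B' -> 0 <= (homog x *m w B') 0 0.
    move=> B'Y; have /inhullE[m [m0 mB <-]] := xB B' B'Y.
    rewrite dot_sum sumr_ge0 // => i _.
    have [iB|/mB->] := boolP (i \in B'); last by rewrite mul0r.
    by rewrite mulr_ge0 // wge.
  by apply: vanish => //; [exact: xge|move=> C /Abig; apply: xge].
pose F := [set i in Y | [forall B in A, homog (v i) *m w B == 0]].
have FY : F \subset Y by apply/fintype.subsetP => i; rewrite inE => /andP[].
have F0 i B : i \in F -> B \in A -> homog (v i) *m w B = 0.
  by rewrite inE => /andP[_ /forall_inP iA] /iA/eqP.
have cardF : (#|Y| <= #|F| + #|A|.+1 * q)%N.
  rewrite -(cardsID F Y) (finset.setIidPr FY) leq_add2l.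
  have YF : Y :\: F \subset (\bigcup_(B in B0 |: A) (Y :\: B))%SET.
    apply/fintype.subsetP => i; rewrite finset.in_setD => /andP[iF iY].
    apply: contraNT iF => iU.
    have iB B : B \in B0 |: A -> i \in B.
      move=> BA; apply: contraNT iU => iB; apply/bigcupP; exists B => //.
      by rewrite finset.in_setD iB iY.
    rewrite inE iY; apply/forall_inP => B BA; apply/eqP.
    apply: vanish BA; first exact: aff_span_mem.
      by apply: wge => //; apply: iB; rewrite setU11.
    by move=> C CA; apply: wge; [exact: Abig|apply: iB; rewrite in_setU1 CA orbT].
  apply: leq_trans (subset_leq_card YF) _.
  apply: leq_trans (card_bigcup_le (q := q) _) _.
    by move=> B; rewrite in_setU1 => /orP[/eqP->|/Abig/andP[]//]; case/andP: B0Y.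
  by rewrite leq_mul2r cardsU1 -add1n leq_add2r leq_b1 orbT.
pose N := (aff_span v F + homog x)%MS.
have NM : (N <= M)%MS.
  rewrite addsmx_sub xY andbT; apply: aff_span_sub => i iF.
  by apply/aff_span_mem/(fintype.subsetP FY).
have Nw B : B \in A -> N *m w B = 0.
  move=> BA; apply/sub_kermxP; rewrite addsmx_sub; apply/andP; split.
    by apply: aff_span_sub => i iF; apply/sub_kermxP; apply: F0.
  by apply/sub_kermxP; apply: x0.
have rkN := rank_common_kernel Ai NM Nw.
have rkN1 : (0 < \rank N)%N.
  by have := mxrankS (addsmxSr (aff_span v F) (homog x)); rewrite homog_rank.
have rkF : (\rank (aff_span v F) <= \rank N)%N by rewrite mxrankS // addsmxSl.
rewrite -/M in rkY.
have [Ak|Ak] := ltnP #|A| k.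
  by apply: (shrink F (k - #|A|)%N) => //; nia.
have AkE : #|A| = k by lia.
have [i iF] : exists i, i \in F by apply/set0Pn; rewrite -card_gt0; nia.
apply: (rational_centre_vertex (fintype.subsetP FY _ iF) _ xB).
apply: (rank1_homog (N := N)); first by lia.
  by apply: submx_trans (addsmxSl _ _); apply: aff_span_mem.
exact: addsmxSr.
Qed.

End RationalModule.

(** * Tverberg numbers *)

Section TverbergNumbers.
Variable R : realType.

Definition centre_property d (S : set 'rV[R]_d) (q N : nat) : Prop :=
  forall v : 'I_N -> 'rV[R]_d, (forall i, S (v i)) ->
    exists2 x, S x & forall B : {set 'I_N}, (#|~: B| <= q)%N -> inhull v B x.

Lemma centre_Tverberg d (S : set 'rV[R]_d) m N : (0 < d)%N -> (0 < m)%N ->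
  centre_property S ((m - 1) * d) N -> Tverberg_property S m N.
Proof.
case: m => // m d0 _; rewrite subSS subn0 => SN X XS.
rewrite card_eq_sym => /card_bijP[f [g fg gf]].
have memI (i : 'I_N) : (i : nat) \in `I_N by apply/mem_set => /=.
pose v (i : 'I_N) : 'rV[R]_d := val (f (SigSub (memI i))).
have vX i : X (v i) by apply/set_mem; exact: valP.
have v_inj : injective v.
  by move=> i j /val_inj/(can_inj fg)/(congr1 val) ij; apply: val_inj.
have [x Sx xB] := SN v (fun i => XS _ (vX i)).
have [|c cP] := @depth_partition R d _ v x m [set: 'I_N]%SET d0.
  by move=> B _; rewrite finset.setTD; apply: xB.
pose P k := [set i in [set: 'I_N]%SET | c i == k].
exists (fun k => [set v i | i in [set` P k]]); split; last first.
  by exists x; split=> [k _|//]; apply: (inhull_conv_hull (cP k)).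
split.
- apply/seteqP; split=> [y [k _ [i _ <-]]|y Xy]; first exact: vX.
  pose n := g (SigSub (mem_set Xy)); have nN : (val n < N)%N := set_mem (valP n).
  exists (c (Ordinal nN)) => //; exists (Ordinal nN).
    by rewrite /= inE finset.in_setT eqxx.
  rewrite /v (_ : SigSub _ = n) ?gf //; exact: val_inj.
- move=> k l _ _ [y [[i + <-] [j + vij]]]; rewrite /= !inE /= => /eqP <- /eqP <-.
  by rewrite (v_inj _ _ vij).
- move=> k _; have [i ik] := set0Pn _ (inhull_neq0 (cP k)).
  by exists (v i); exists i.
Qed.

Lemma Tverberg_number_le d (S : set 'rV[R]_d) m N : (0 < N)%N ->
  Tverberg_property S m N -> (Tverberg_number S m <= N%:R%:E)%E.
Proof.
move=> N0 SN; rewrite /Tverberg_number; case: pselect => [ex|nex].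
  rewrite lee_fin ler_nat; case: ex_minnP => k _; apply.
  exact/asboolP.
by case: nex; exists N; apply/asboolP.
Qed.

Lemma helly_centre_property d (S : set 'rV[R]_d) h q N : helly S h ->
  (h * q < N)%N -> centre_property S q N.
Proof.
move=> Sh hN v vS; have [i _||x Sx xB] := helly_centre (v := v) (Y := [set: 'I_N]%SET) (q := q) Sh.
- exact: vS.
- by rewrite cardsT card_ord.
- by exists x => // B Bq; apply: xB; rewrite ?finset.subsetT // finset.setTD.
Qed.

Lemma helly_integers n :
  helly [set x : 'rV[R]_n | forall i, x 0 i \is a Num.int] (2 ^ n).
Proof.
apply: (@helly_lattice _ _ _ 1) => //.
  split=> [|x y]; first by apply/mem_set => i; rewrite mxE rpred0.
  move=> /set_mem xi /set_mem yi; apply/mem_set => i.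
  by rewrite !mxE; apply: rpredB; [exact: xi|exact: yi].
move=> x xi x1; apply/rowP => i; rewrite mxE.
have /intrP[z xz] := xi i; have := x1 i; rewrite xz -intr_norm -[1]/(1%:~R) ltr_int.
by move=> z1; have -> : z = 0 by lia.
Qed.

Lemma helly_mixed_integer d a : (a <= d)%N ->
  helly (mixed_integer_space R d a) (2 ^ (d - a) * (a + 1)).
Proof.
move=> /subnK; set n := (d - a)%N; move: n => n <-.
have -> : mixed_integer_space R (n + a) a
    = [set x : 'rV[R]_(n + a) | forall i, lsubmx x 0 i \is a Num.int].
  apply/seteqP; split=> x xi i; first by move=> *; rewrite mxE; apply: xi; rewrite addnK /=.
  rewrite addnK => il; have -> : i = lshift a (Ordinal il) by apply: val_inj.
  by have := xi (Ordinal il); rewrite mxE.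
exact: (@helly_mixed R n a _ _ (@helly_integers n)).
Qed.

Lemma lattice_separation d (L : set 'rV[R]_d) : is_lattice L ->
  exists2 e, 0 < e & forall x, L x -> (forall i, `|x 0 i| < e) -> x = 0.
Proof.
move=> [[L0 _] Liso]; have [_ [V V0 VL]] := Liso _ (set_mem L0).
have [e /= e0 eV] := (nbhs_ballP _ _).1 V0.
exists e => // x Lx xe; suff : (V `&` L) x by rewrite VL.
split=> //; apply: eV; split=> // i j.
by rewrite [i]ord1 mxE /ball /= sub0r normrN.
Qed.

Lemma rat_module_centre d (S : set 'rV[R]_d) q N : (0 < d)%N -> is_rat_module S ->
  (2 * d * q < N)%N -> centre_property S q N.
Proof.
move=> d0 [[S0 SB] SQ] dN v vS.
have [||c [_ _ cB]] := @rational_centre R d _ v q d [set: 'I_N]%SET.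
- by rewrite -[d.+1]addn1; apply: rank_leq_col.
- rewrite cardsT card_ord (_ : maxn _ _ = (2 * d)%N) //.
  by apply/maxn_idPl; lia.
exists (\sum_i ratr (c i) *: v i) => [|B Bq]; last first.
  by apply: cB; rewrite /big_in finset.subsetT finset.setTD.
have [_ SD] := GRing.zmod_closedD (conj S0 SB).
by apply/set_mem; elim/big_ind: _ => // i _; apply/mem_set/SQ.
Qed.

End TverbergNumbers.

Unset Implicit Arguments.

Theorem corollary1p5 (R : realType) (d m : nat) (hd : (1 <= d)%N)
    (hm : (1 <= m)%N) :
  [/\ forall a : nat, (a <= d)%N ->
        (Tverberg_number (mixed_integer_space R d a) m
          <= ((m - 1) * d * (2 ^ (d - a) * (a + 1)) + 1)%N%:R%:E)%E,
      forall L L' L'' : set 'rV[R]_d,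
        is_lattice L -> is_sublattice L' L -> is_sublattice L'' L ->
        (Tverberg_number (L `\` (L' `|` L'')) m
          <= (6 * (m - 1) * d * 2 ^ d + 1)%N%:R%:E)%E
    & forall S : set 'rV[R]_d, is_rat_module S ->
        (Tverberg_number S m <= (2 * (m - 1) * d ^ 2 + 1)%N%:R%:E)%E].
Proof.
split=> [a ad|L L' L'' Llat [L'z _] [L''z _]|S Smod];
  apply: Tverberg_number_le; rewrite ?addn1 //; apply: centre_Tverberg => //.
- apply: helly_centre_property (helly_mixed_integer ad) _.
  by rewrite ltnS mulnC addn1.
- have [e e0 Lsep] := lattice_separation Llat; have [Lz _] := Llat.
  apply: helly_centre_property (helly_lattice_diff Lz e0 Lsep L'z L''z) _.
  by rewrite ltnS; apply: eq_leq; ring.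
- by apply: rat_module_centre => //; rewrite ltnS; apply: eq_leq; ring.
Qed.
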